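(* Let $X$ be a real Banach space containing (an isomorphic copy of) $c_0$ and having a countable norming system of functionals. Then, for every $0<\varepsilon<2$, there is an equivalent Read norm $p_\varepsilon$ on $X$ satisfying the following: (a) $(X,p_\varepsilon)$ is strictly convex; (b) every convex combination of slices of the unit ball of $(X,p_\varepsilon)$ has diameter $\ge 2-\varepsilon$, so every non-empty relatively weakly open subset of the unit ball of $(X,p_\varepsilon)$ has diameter $\ge 2-\varepsilon$; (c) the norm of $(X,p_\varepsilon)^*$ is $(2-\varepsilon)$-rough; and moreover, if $X^*$ is separable, also: (d) $(X,p_\varepsilon)^{**}$ is strictly convex, so $(X,p_\varepsilon)^*$ is smooth.
   Context: All Banach spaces are real. $\mathrm{NA}(X,p)$ is the set of functionals $f\in X^*$ attaining their norm on the unit sphere of $(X,p)$. An equivalent norm $p$ on $X$ is a Read norm if $\mathrm{NA}(X,p)$ does not contain any two-dimensional linear subspace. A countable norming system of functionals of $X$ is a bounded subset $\{x_n^*: n\in\mathbb N\}$ of $X^*$ for which there is a constant $K\ge 0$ with $\|x\|\le K\sup_n|x_n^*(x)|$ for all $x\in X$. A Banach space is strictly convex if its unit sphere contains no non-trivial segment; it is smooth if its norm is Gâteaux differentiable at every non-zero element. A norm $\|\cdot\|$ on $X$ is $\rho$-rough ($0<\rho\le 2$) if $\limsup_{\|h\|\to0}\frac{\|x+h\|+\|x-h\|-2\|x\|}{\|h\|}\ge\rho$ for every $x\in X$. A slice of the unit ball $B$ is a set $\{x\in B: f(x)>\sup_B f-\alpha\}$ with $f$ a non-zero bounded linear functional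 and $\alpha>0$; a convex combination of slices is a set $\sum_{i=1}^N t_iS_i$ with $S_i$ slices, $t_i\ge0$, $\sum_i t_i=1$. Diameters are measured in the norm $p_\varepsilon$. *)

(* Defs.v *)
From HB Require Import structures.
From mathcomp Require Import all_boot all_order all_algebra.
From mathcomp Require Import all_classical all_reals all_analysis.

Set Implicit Arguments.
Unset Strict Implicit.
Unset Printing Implicit Defensive.

Import Order.TTheory GRing.Theory Num.Theory.
Import numFieldNormedType.Exports.

Local Open Scope classical_set_scope.
Local Open Scope ring_scope.

Section DualSpace.
Context {R : realType} (X : normedModType R).

Definition dual_pred : {pred X -> R^o} :=
  mem [set f : X -> R^o | linear f /\ continuous f].

Lemma dual_predP (f : X -> R^o) :
  reflect (linear f /\ continuous f) (f \in dual_pred).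
Proof. by apply: (iffP idP) => [/set_mem|/mem_set]. Qed.

Lemma dual_pred_submod : submod_closed dual_pred.
Proof.
split=> [|a f g /dual_predP[lf cf] /dual_predP[lg cg]]; apply/dual_predP; split.
- have z x : (0 : X -> R^o) x = 0 by [].
  by move=> a x y; rewrite !z scaler0 addr0.
- by move=> x; exact: cvg_cst.
- have z x : (a *: f + g) x = a *: f x + g x by [].
  by move=> b x y; rewrite !z lf lg !scalerDr addrACA !scalerA (mulrC a b).
- by move=> x; apply: cvgD; [apply: cvgZr; exact: cf|exact: cg].
Qed.

HB.instance Definition _ :=
  GRing.isSubmodClosed.Build R (X -> R^o) dual_pred dual_pred_submod.

Record dual : Type := Dual {
  dual_fun :> X -> R^o;
  dual_funP : dual_fun \in dual_pred
}.

HB.instance Definition _ := [isSub for dual_fun].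
HB.instance Definition _ := [Choice of dual by <:].
HB.instance Definition _ := [SubChoice_isSubLmodule of dual by <:].

Lemma dual_linear (f : dual) : linear f.
Proof. by have /dual_predP[] := dual_funP f. Qed.

HB.instance Definition _ (f : dual) :=
  GRing.isLinear.Build R X R^o *:%R (dual_fun f) (@dual_linear f).

Lemma dual_continuous (f : dual) : continuous f.
Proof. by have /dual_predP[] := dual_funP f. Qed.

Lemma dual_bound (f : dual) : exists2 M, 0 <= M & forall x, `|f x| <= M * `|x|.
Proof.
have /linear_boundedP := (linear_bounded_continuous f).2 (@dual_continuous f).
by move=> /pinfty_ex_gt0[M M0 fM]; exists M => //; exact: ltW.
Qed.

(** The norm of [f] in the dual of [(X, p)], for a norm [p] on [X] that is
    equivalent to the given one; the underlying space of functionals does not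
    depend on [p]. *)
Definition dual_norm (p : X -> R) (f : dual) : R :=
  sup [set `|f x| | x in [set x | p x <= 1]].

Let opnorm (f : dual) : R := dual_norm Num.norm f.

Let opnorm_has_sup (f : dual) :
  has_sup [set `|f x| | x in [set x : X | `|x| <= 1]].
Proof.
split; first by exists `|f 0|; exists 0 => //=; rewrite normr0 ler01.
have [M M0 fM] := dual_bound f; exists M => _ [x /= x1 <-].
by rewrite (le_trans (fM x))// ler_piMr.
Qed.

Let opnorm_le (f : dual) x : `|f x| <= opnorm f * `|x|.
Proof.
have [->|x0] := eqVneq x 0; first by rewrite linear0 !normr0 mulr0.
rewrite -ler_pdivrMr ?normr_gt0//.
have -> : `|f x| / `|x| = `|f (`|x|^-1 *: x)|.
  by rewrite linearZ /= normrM mulrC normfV normr_id.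
apply: ub_le_sup; first exact: (opnorm_has_sup f).2.
by exists (`|x|^-1 *: x) => //=; rewrite normrZ normfV normr_id mulVf ?normr_eq0.
Qed.

Let opnorm_ub (f : dual) M : (forall x, `|x| <= 1 -> `|f x| <= M) ->
  opnorm f <= M.
Proof.
move=> fM; apply: ge_sup; first exact: (opnorm_has_sup f).1.
by move=> _ [x /= x1 <-]; exact: fM.
Qed.

Let opnorm_ge0 (f : dual) : 0 <= opnorm f.
Proof.
apply: ub_le_sup; first exact: (opnorm_has_sup f).2.
by exists 0; rewrite /= ?normr0 ?ler01// linear0 normr0.
Qed.

Let opnormD (f g : dual) : opnorm (f + g) <= opnorm f + opnorm g.
Proof.
apply: opnorm_ub => x x1; rewrite /= (le_trans (ler_normD (f x) (g x)))//.
by rewrite lerD// (le_trans (opnorm_le _ _))// ler_piMr.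
Qed.

Let opnormZ_le (l : R) (f : dual) : opnorm (l *: f) <= `|l| * opnorm f.
Proof.
apply: opnorm_ub => x x1; rewrite [(_ *: f) x]/(l * f x) normrM.
by rewrite ler_wpM2l// (le_trans (opnorm_le _ _))// ler_piMr.
Qed.

Let opnorm0 : opnorm 0 = 0.
Proof.
apply/eqP; rewrite eq_le opnorm_ge0 andbT.
by apply: opnorm_ub => x _; rewrite [(0 : dual) x]/(0 : R) normr0.
Qed.

Let opnormZ (l : R) (f : dual) : opnorm (l *: f) = `|l| * opnorm f.
Proof.
have [->|l0] := eqVneq l 0; first by rewrite scale0r normr0 mul0r opnorm0.
apply/eqP; rewrite eq_le opnormZ_le/= -ler_pdivlMl ?normr_gt0//.
rewrite -normfV; apply: le_trans (opnormZ_le _ _).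
by rewrite scalerA mulVf// scale1r.
Qed.

Let opnorm_eq0 (f : dual) : opnorm f = 0 -> f = 0.
Proof.
move=> f0; apply: val_inj; apply/funext => x /=.
have := opnorm_le f x; rewrite f0 mul0r normr_le0 => /eqP ->.
by [].
Qed.

HB.instance Definition _ :=
  Lmodule_isNormed.Build R dual opnormD opnormZ opnorm_eq0.

Lemma dual_normE (f : dual) : `|f| = dual_norm Num.norm f.
Proof. by []. Qed.

(** The weak topology of [X]: the initial topology for the family of all
    elements of the dual. *)
Definition weak : Type :=
  initial_topology (fun x : X => (fun f : dual => f x) : {ptws dual -> R^o}).

HB.instance Definition _ := Topological.on weak.

Definition weakly_open (W : set X) : Prop := open (W : set weak).

End DualSpace.

Section CZero.
Context (R : realType).

Definition c0_pred : {pred nat -> R^o} :=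
  mem [set u : nat -> R^o | u @ \oo --> (0 : R^o)].

Lemma c0_predP (u : nat -> R^o) :
  reflect (u @ \oo --> (0 : R^o)) (u \in c0_pred).
Proof. by apply: (iffP idP) => [/set_mem|/mem_set]. Qed.

Lemma c0_pred_submod : submod_closed c0_pred.
Proof.
split=> [|a u v /c0_predP u0 /c0_predP v0]; apply/c0_predP.
- exact: cvg_cst.
- rewrite -[X in _ --> X]addr0 -[X in _ --> X + _](scaler0 _ a).
  by apply: cvgD => //; exact: cvgZr.
Qed.

HB.instance Definition _ :=
  GRing.isSubmodClosed.Build R (nat -> R^o) c0_pred c0_pred_submod.

Record c0 : Type := C0 {
  c0_fun :> nat -> R^o;
  c0_funP : c0_fun \in c0_pred
}.

HB.instance Definition _ := [isSub for c0_fun].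
HB.instance Definition _ := [Choice of c0 by <:].
HB.instance Definition _ := [SubChoice_isSubLmodule of c0 by <:].

Definition c0_norm (u : c0) : R := sup (range (fun n => `|u n|)).

Let c0_has_sup (u : c0) : has_sup (range (fun n => `|u n|)).
Proof.
split; first by exists `|u 0%N|; exists 0%N.
have /c0_predP u0 := c0_funP u.
have /cvg_seq_bounded[M [_ uM]] : cvgn (u : nat -> R^o) by apply/cvg_ex; exists 0.
exists (M + 1) => _ [n _ <-].
by apply: (uM (M + 1)); rewrite ?ltrDl.
Qed.

Let c0_norm_le (u : c0) n : `|u n| <= c0_norm u.
Proof. by apply: ub_le_sup; [exact: (c0_has_sup u).2|exists n]. Qed.

Let c0_norm_ub (u : c0) M : (forall n, `|u n| <= M) -> c0_norm u <= M.
Proof.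
move=> uM; apply: ge_sup; first exact: (c0_has_sup u).1.
by move=> _ [n _ <-].
Qed.

Let c0_normD (u v : c0) : c0_norm (u + v) <= c0_norm u + c0_norm v.
Proof.
by apply: c0_norm_ub => n; rewrite (le_trans (ler_normD (u n) (v n)))// lerD.
Qed.

Let c0_normZ_le (l : R) (u : c0) : c0_norm (l *: u) <= `|l| * c0_norm u.
Proof.
apply: c0_norm_ub => n; rewrite [(_ *: u) n]/(l * u n) normrM.
by rewrite ler_wpM2l.
Qed.

Let c0_norm0 : c0_norm 0 = 0.
Proof.
apply/eqP; rewrite eq_le (le_trans _ (c0_norm_le 0 0%N))// andbT.
by apply: c0_norm_ub => n; rewrite [(0 : c0) n]/(0 : R) normr0.
Qed.

Let c0_normZ (l : R) (u : c0) : c0_norm (l *: u) = `|l| * c0_norm u.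
Proof.
have [->|l0] := eqVneq l 0; first by rewrite scale0r normr0 mul0r c0_norm0.
apply/eqP; rewrite eq_le c0_normZ_le/= -ler_pdivlMl ?normr_gt0//.
rewrite -normfV; apply: le_trans (c0_normZ_le _ _).
by rewrite scalerA mulVf// scale1r.
Qed.

Let c0_norm_eq0 (u : c0) : c0_norm u = 0 -> u = 0.
Proof.
move=> u0; apply: val_inj; apply/funext => n /=.
by have := c0_norm_le u n; rewrite u0 normr_le0 => /eqP ->.
Qed.

HB.instance Definition _ :=
  Lmodule_isNormed.Build R c0 c0_normD c0_normZ c0_norm_eq0.

End CZero.

Definition contains_copy {R : realType} (Y X : normedModType R) : Prop :=
  exists (T : {linear Y -> X}) (m M : R), 0 < m /\
    forall y, m * `|y| <= `|T y| <= M * `|y|.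

Definition separable (T : topologicalType) : Prop :=
  exists2 A : set T, countable A & dense A.

Definition norming_system {R : realType} {X : normedModType R}
    (xs : nat -> dual X) : Prop :=
  bounded_set (range xs) /\
  exists2 K : R, 0 <= K &
    forall x : X, `|x| <= K * sup (range (fun n => `|xs n x|)).

(** Norms are handled as functions, so that several norms can be considered on
    the same space [V], whose own norm only provides the topology. The notions
    below are meant for norms [q] equivalent to that of [V]. *)
Section Norms.
Context {R : realType} {V : normedModType R}.
Implicit Types (q : V -> R) (A B : set V).

Definition equivalent_norm q : Prop :=
  [/\ forall x y, q (x + y) <= q x + q y,
      forall a x, q (a *: x) = `|a| * q x,
      forall x, q x = 0 -> x = 0 &
      exists m M : R, 0 < m /\ forall x, m * `|x| <= q x <= M * `|x|].

Definition unit_ball q : set V := [set x | q x <= 1].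

Definition unit_sphere q : set V := [set x | q x = 1].

Definition segment (x y : V) : set V :=
  [set (1 - t) *: x + t *: y | t in `[0, 1]].

Definition strictly_convex q : Prop :=
  forall x y, x != y -> ~ segment x y `<=` unit_sphere q.

Definition gateaux_differentiable q (x : V) : Prop :=
  exists D : dual V, forall h, is_derive x h (q : V -> R^o) (D h).

Definition smooth q : Prop := forall x, x != 0 -> gateaux_differentiable q x.

Definition rough (rho : R) q : Prop :=
  forall x, (rho%:E <=
    limf_esup (fun h : V => ((q (x + h) + q (x - h) - 2 * q x) / q h)%:E)
              (dnbhs (0%R : V)))%E.

Definition diam q A : \bar R :=
  ereal_sup [set (q (x - y))%:E | x in A & y in A].

Definition slice B (f : dual V) (alpha : R) : set V :=
  [set x | B x /\ sup (f @` B) - alpha < f x].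

Definition is_slice B (S : set V) : Prop :=
  exists (f : dual V) (alpha : R), [/\ f != 0, 0 < alpha & S = slice B f alpha].

Definition is_convex_combination_of_slices B (C : set V) : Prop :=
  exists (N : nat) (t : 'I_N -> R) (S : 'I_N -> set V),
    [/\ forall i, is_slice B (S i), forall i, 0 <= t i, \sum_i t i = 1 &
        C = [set \sum_i t i *: s i | s in [set s | forall i, S i (s i)]]].

Definition two_dimensional_subspace (L : set V) : Prop :=
  exists u v : V,
    (forall a b : R, a *: u + b *: v = 0 -> a = 0 /\ b = 0) /\
    L = [set a *: u + b *: v | a in setT & b in setT].

Definition norm_attaining q : set (dual V) :=
  [set f : dual V | exists2 x, unit_sphere q x & `|f x| = dual_norm q f].

End Norms.

Definition read_norm {R : realType} {X : normedModType R} (p : X -> R) : Prop :=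
  equivalent_norm p /\
  ~ exists2 L : set (dual X), two_dimensional_subspace L & L `<=` norm_attaining p.

(* Main.v *)
(** Let [T] embed c0 into [X], [e n = T (unit n)], and let [E n] be Hahn-Banach
    extensions of the coordinate functionals. The norm [nu x], the maximum of
    [sup_n |E n x|] and of a large multiple of the distance from [x] to the copy
    of c0, is equivalent, and at each [x <> 0] almost no [E n] is active: moving
    [x] slightly along [e n] does not increase [nu] for large [n].

    The new norm is [p x = nu x + sum_n r n * |v n x|] with
    [v n = u n + w n * E n], where [u n] runs through all integer combinations of
    a countable total family, each repeated infinitely often, and [r n], [w n]
    decrease fast. Along a subsequence of [e] the functionals [u k], [k <= n],
    nearly vanish at [e n]; hence if [h] attains its norm at [x] then [h (e n)] is
    the sign of [v n x] times a fixed quantity, up to a much smaller error. For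
    [h = f, g, f + g, f - g] these signs contradict linearity, so the
    norm-attaining functionals contain no plane.

    The functionals [v n] take opposite signs at any two independent points, which
    makes [p] strictly convex; if the total family is dense in the dual, the same
    holds on the bidual, whose norm also splits off the term [r n * |F (v n)|].
    For the diameters, the [E n]-coordinate of a unit vector [x] can be replaced
    by [+- nu x] almost without leaving the unit ball; since [e n] is weakly null,
    both vectors are weakly close to [x]. *)

From HB Require Import structures.
Require Import Defs.
From mathcomp Require Import all_boot all_order all_algebra.
From mathcomp Require Import all_classical all_reals all_analysis.
From mathcomp Require Import ring lra zify.

Set Implicit Arguments.
Unset Strict Implicit.
Unset Printing Implicit Defensive.

Import Order.TTheory GRing.Theory Num.Theory.
Import numFieldNormedType.Exports.

Local Open Scope classical_set_scope.
Local Open Scope ring_scope.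

(** * Sublinear functionals and the Hahn-Banach theorem *)

Section HahnBanach.
Context {R : realType}.

Definition sublinear (V : lmodType R) (q : V -> R) : Prop :=
  [/\ q 0 = 0, forall x y, q (x + y) <= q x + q y &
      forall a x, 0 < a -> q (a *: x) <= a * q x].

(** [G z c] stands for the constraint that a functional be at most [c] at [z]; sums and positive
    multiples of such constraints follow from them. *)
Definition convex_cone (V : lmodType R) (G : V -> R -> Prop) : Prop :=
  [/\ G 0 0, forall z c z' c', G z c -> G z' c' -> G (z + z') (c + c') &
      forall a z c, 0 < a -> G z c -> G (a *: z) (a * c)].

(** The largest sublinear functional below [q] that is at most [c] at [z]
    whenever [G z c]. *)
Definition lower_sublinear (V : lmodType R) (q : V -> R) (G : V -> R -> Prop)
    (x : V) : R :=
  inf [set r | exists z c, G z c /\ r = q (x - z) + c].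

Section LowerSublinear.
Context (V : lmodType R) (q : V -> R) (G : V -> R -> Prop).
Hypotheses (sq : sublinear q) (cG : convex_cone G).
Hypothesis qG : forall z c, G z c -> - c <= q (- z).

Let lbG x : has_lbound [set r | exists z c, G z c /\ r = q (x - z) + c].
Proof.
have [_ qD _] := sq.
exists (- q (- x)) => _ [z [c [Gzc ->]]].
have := qG Gzc; have := qD (x - z) (- x).
by rewrite addrAC subrr add0r; lra.
Qed.

Lemma lower_sublinear_le x z c : G z c -> lower_sublinear q G x <= q (x - z) + c.
Proof. by move=> Gzc; apply: ge_inf => //; exists z, c. Qed.

Lemma lower_sublinear_ge x m :
  (forall z c, G z c -> m <= q (x - z) + c) -> m <= lower_sublinear q G x.
Proof.
move=> mG; apply: lb_le_inf; last by move=> _ [z [c [Gzc ->]]]; exact: mG.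
by have [G00 _ _] := cG; exists (q (x - 0) + 0), 0, 0.
Qed.

Lemma lower_sublinear_lt x m : lower_sublinear q G x < m ->
  exists z c, G z c /\ q (x - z) + c < m.
Proof.
move=> qm; apply/not_existsP => h.
have : m <= lower_sublinear q G x.
  apply: lower_sublinear_ge => z c Gzc; rewrite leNgt; apply/negP => lt_m.
  by apply: (h z); exists c.
by rewrite leNgt qm.
Qed.

Lemma lower_sublinear_le_base x : lower_sublinear q G x <= q x.
Proof.
have [G00 _ _] := cG.
by have := lower_sublinear_le x G00; rewrite subr0 addr0.
Qed.

Lemma lower_sublinear_le_cone z c : G z c -> lower_sublinear q G z <= c.
Proof.
have [q0 _ _] := sq.
by move=> Gzc; have := lower_sublinear_le z Gzc; rewrite subrr q0 add0r.
Qed.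

Lemma lower_sublinear_sublinear : sublinear (lower_sublinear q G).
Proof.
have [q0 qD qZ] := sq; have [G00 GD GZ] := cG.
split=> [|x y|a x a0].
- apply/eqP; rewrite eq_le; apply/andP; split.
    by rewrite -[leRHS]q0 lower_sublinear_le_base.
  by apply: lower_sublinear_ge => z c /qG; rewrite sub0r; lra.
- rewrite leNgt; apply/negP; set m := lower_sublinear q G (x + y).
  set mx := lower_sublinear q G x; set my := lower_sublinear q G y => lt_m.
  have [|z [c [Gzc xz]]] := @lower_sublinear_lt x (mx + (m - mx - my) / 2).
    by rewrite -/mx; lra.
  have [|z' [c' [Gzc' yz]]] := @lower_sublinear_lt y (my + (m - mx - my) / 2).
    by rewrite -/my; lra.
  have := lower_sublinear_le (x + y) (GD _ _ _ _ Gzc Gzc'); rewrite -/m.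
  by rewrite opprD addrACA; have := qD (x - z) (y - z'); lra.
- rewrite -ler_pdivrMl//; apply: lower_sublinear_ge => z c Gzc.
  rewrite ler_pdivrMl//; have := lower_sublinear_le (a *: x) (GZ _ _ _ a0 Gzc).
  by rewrite -scalerBr; have := qZ a (x - z) a0; lra.
Qed.

End LowerSublinear.

Definition ray (V : lmodType R) (h : V) (r : R) (z : V) (c : R) : Prop :=
  exists2 t, 0 <= t & z = t *: h /\ c = t * r.

Lemma ray_convex_cone (V : lmodType R) (h : V) (r : R) : convex_cone (ray h r).
Proof.
split=> [|_ _ _ _ [t t0 [-> ->]] [t' t'0 [-> ->]]|a _ _ a0 [t t0 [-> ->]]].
- by exists 0 => //; rewrite scale0r mul0r.
- by exists (t + t'); [exact: addr_ge0|rewrite scalerDl mulrDl].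
- by exists (a * t); [rewrite mulr_ge0// ltW|rewrite scalerA mulrA].
Qed.

Lemma sublinearZ (V : lmodType R) (q : V -> R) (a : R) x :
  sublinear q -> 0 <= a -> q (a *: x) = a * q x.
Proof.
move=> [q0 _ qZ]; rewrite le_eqVlt => /predU1P[<-|a0].
  by rewrite scale0r mul0r q0.
apply/eqP; rewrite eq_le qZ//= -ler_pdivlMl//.
have := qZ a^-1 (a *: x); rewrite invr_gt0 a0 scalerA mulVf ?gt_eqF// scale1r.
exact.
Qed.

Lemma sublinear_odd_linear (V : lmodType R) (q : V -> R) : sublinear q ->
  (forall x, q (- x) <= - q x) -> linear (q : V -> R^o).
Proof.
move=> sq qN; have [q0 qD qZ] := sq.
have qNE x : q (- x) = - q x.
  apply/eqP; rewrite eq_le qN/=.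
  by have := qD x (- x); rewrite subrr q0; lra.
have qDE x y : q (x + y) = q x + q y.
  apply/eqP; rewrite eq_le qD/=.
  by have := qD (- x) (- y); rewrite -opprD !qNE; lra.
move=> a x y; rewrite qDE; congr (_ + _).
have [a0|a0] := leP 0 a; first by rewrite (sublinearZ _ sq).
rewrite -[a]opprK scaleNr qNE (sublinearZ _ sq) ?oppr_ge0 1?ltW//.
by rewrite scaleNr.
Qed.

(** A minimal sublinear functional [m] is linear: [lower_sublinear m] along the
    ray of [- h] with value [- m h] cannot be smaller than [m], so
    [m (- h) <= - m h]. *)
Theorem hahn_banach (V : lmodType R) (q : V -> R) : sublinear q ->
  exists2 f : V -> R, linear (f : V -> R^o) & forall x, f x <= q x.
Proof.
(* Zorn's lemma for the reversed pointwise order, so that a maximal element is a minimal functional;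
   [q] itself bounds the empty chain. *)
move=> sq; pose T := {m : V -> R | sublinear m /\ forall x, m x <= q x}.
pose t0 : T := exist _ q (conj sq (fun x => lexx _)).
have [|r s t rs st|A Atot|] := @ZL_preorder T t0
  (fun m m' => `[< forall x, sval m' x <= sval m x >]).
- by move=> m; apply/asboolP.
- move/asboolP in rs; move/asboolP in st.
  by apply/asboolP => x; exact: le_trans (st x) (rs x).
- have [A0|A0] := pselect (exists t, A t); last first.
    by exists t0 => s As; case: A0; exists s.
  (* The infimum of a chain is finite, since a member [m] satisfies
     [m x >= - m (- x) >= - q (- x)]. *)
  pose I x := [set sval t x | t in A].
  have lb x : has_lbound (I x).
    exists (- q (- x)) => _ [[m [[m0 mD _] mq]] _ <-] /=.
    by have := mD x (- x); rewrite subrr m0; have := mq (- x); lra.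
  have ne x : I x !=set0 by have [t At] := A0; exists (sval t x), t.
  have Ile t x : A t -> inf (I x) <= sval t x.
    by move=> At; apply: ge_inf => //; exists t.
  have Ige x m : (forall t, A t -> m <= sval t x) -> m <= inf (I x).
    by move=> mA; apply: lb_le_inf => // _ [t At <-]; exact: mA.
  have sI : sublinear (fun x => inf (I x)).
    split=> [|x y|a x a0].
    + apply/eqP; rewrite eq_le; apply/andP; split.
        by have [t At] := A0; have [[tt _ _] _] := svalP t; rewrite -tt Ile.
      by apply: Ige => t At; have [[-> _ _] _] := svalP t.
    + rewrite leNgt; apply/negP; set m := inf (I (x + y)).
      set mx := inf (I x); set my := inf (I y) => lt_m.
      have [_ [t At <-] tx] : exists2 r, I x r & r < mx + (m - mx - my) / 2.
        by apply: inf_lt => //; rewrite -/mx; lra.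
      have [_ [t' At' <-] ty] : exists2 r, I y r & r < my + (m - mx - my) / 2.
        by apply: inf_lt => //; rewrite -/my; lra.
      have [[_ tD _] _] := svalP t; have [[_ t'D _] _] := svalP t'.
      have := Ile t (x + y) At; have := Ile t' (x + y) At'; rewrite -/m.
      have := tD x y; have := t'D x y.
      (* The smaller of the two nearly optimal members is nearly optimal at both [x] and [y]. *)
      have [/asboolP tt'|/asboolP tt'] := Atot _ _ At At'.
        by have := tt' x; lra.
      by have := tt' y; lra.
    + rewrite -ler_pdivrMl//; apply: Ige => t At.
      have [[_ _ tZ] _] := svalP t.
      by rewrite ler_pdivrMl//; exact: le_trans (Ile _ _ At) (tZ _ _ a0).
  have Iq x : inf (I x) <= q x.
    have [t At] := A0; have [_ tq] := svalP t.
    exact: le_trans (Ile _ _ At) (tq _).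
  exists (exist _ (fun x => inf (I x)) (conj sI Iq)) => s As.
  by apply/asboolP => x /=; exact: Ile.
- move=> [m [sm mq]] mmin; exists m => //.
  apply: sublinear_odd_linear => // h.
  have cG := ray_convex_cone (- h) (- m h).
  have mG z c : ray (- h) (- m h) z c -> - c <= m (- z).
    by move=> [t t0' [-> ->]]; rewrite scalerN opprK (sublinearZ _ sm)//; lra.
  have sl := lower_sublinear_sublinear sm cG mG.
  have lm x := lower_sublinear_le_base sm cG mG x.
  have slq x : lower_sublinear m (ray (- h) (- m h)) x <= q x.
    exact: le_trans (lm x) (mq x).
  have /asboolP mle := mmin (exist _ _ (conj sl slq)) (asboolT lm).
  apply: le_trans (mle (- h)) _ => /=.
  apply: lower_sublinear_le_cone => //.
  by exists 1 => //; rewrite scale1r mul1r.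
Qed.

(** Any linear functional below [lower_sublinear q G] meets both demands. The graph of a functional
    on a subspace as [G] gives extensions; a cone with two generators gives supporting functionals
    of prescribed slope. *)
Theorem hahn_banach_cone (V : lmodType R) (q : V -> R) (G : V -> R -> Prop) :
  sublinear q -> convex_cone G -> (forall z c, G z c -> - c <= q (- z)) ->
  exists f : V -> R, [/\ linear (f : V -> R^o), forall x, f x <= q x &
    forall z c, G z c -> f z <= c].
Proof.
move=> sq cG qG; have [f lf fq] := hahn_banach (lower_sublinear_sublinear sq cG qG).
exists f; split=> [//|x|z c Gzc]; apply: le_trans (fq _) _.
- exact: lower_sublinear_le_base.
- exact: lower_sublinear_le_cone.
Qed.

End HahnBanach.

(** * Dual norms *)

Section Seminorm.
Context {R : realType} {V : lmodType R}.
Implicit Types (q : V -> R) (x y : V).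

Definition seminorm q : Prop :=
  (forall x y, q (x + y) <= q x + q y) /\ (forall a x, q (a *: x) = `|a| * q x).

Lemma seminorm0 q : seminorm q -> q 0 = 0.
Proof. by move=> [_ qZ]; rewrite -(scale0r 0) qZ normr0 mul0r. Qed.

Lemma seminormN q x : seminorm q -> q (- x) = q x.
Proof. by move=> [_ qZ]; rewrite -scaleN1r qZ normrN1 mul1r. Qed.

Lemma seminorm_ge0 q x : seminorm q -> 0 <= q x.
Proof.
move=> sq; have [qD _] := sq; have := qD x (- x).
by rewrite (seminormN _ sq) subrr (seminorm0 sq); lra.
Qed.

Lemma seminorm_sublinear q : seminorm q -> sublinear q.
Proof.
move=> sq; have [qD qZ] := sq; split=> // [|a x a0]; first exact: seminorm0.
by rewrite qZ gtr0_norm.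
Qed.

Lemma seminormD q q' : seminorm q -> seminorm q' -> seminorm (fun x => q x + q' x).
Proof.
move=> [qD qZ] [q'D q'Z]; split=> [x y|a x]; last by rewrite qZ q'Z mulrDr.
by have := qD x y; have := q'D x y; lra.
Qed.

Lemma sublinear_seminorm q : sublinear q -> (forall x, q (- x) = q x) -> seminorm q.
Proof.
move=> sq qN; have [_ qD _] := sq; split=> // a x.
have [a0|a0] := leP 0 a; first by rewrite (sublinearZ _ sq)// ger0_norm.
by rewrite -qN -scaleNr (sublinearZ _ sq) ?oppr_ge0 ?ltr0_norm// ltW.
Qed.

End Seminorm.

Section DualNorm.
Context {R : realType}.

Lemma equivalent_norm_seminorm {V : normedModType R} (q : V -> R) :
  equivalent_norm q -> seminorm q.
Proof. by case. Qed.

Lemma norm_equivalent_norm (V : normedModType R) :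
  equivalent_norm (Num.norm : V -> R).
Proof.
split; [exact: ler_normD|exact: normrZ|by move=> x /eqP; rewrite normr_eq0 => /eqP|].
by exists 1, 1; split=> // x; rewrite mul1r lexx.
Qed.

Lemma equivalent_norm_between {V : normedModType R} (q q' : V -> R) (K : R) :
  equivalent_norm q -> seminorm q' -> (forall x, q x <= q' x <= K * q x) ->
  equivalent_norm q'.
Proof.
move=> [_ _ _ [m [M [m0 qmM]]]] sq' qq'; have [q'D q'Z] := sq'.
split=> // [x q'x0|].
  have := qmM x; have := qq' x; rewrite q'x0 => /andP[qx0 _] /andP[mx _].
  by apply/eqP; rewrite -normr_le0 -(pmulr_rle0 `|x| m0) (le_trans mx).
exists m, (Num.max K 0 * M); split=> // x.
have /andP[mx Mx] := qmM x; have /andP[h1 h2] := qq' x.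
apply/andP; split; first lra.
have qx0 : 0 <= q x by apply: le_trans mx; rewrite mulr_ge0// ltW.
apply: (le_trans h2); apply: (@le_trans _ _ (Num.max K 0 * q x)).
  by rewrite ler_wpM2r// le_max lexx.
by rewrite -mulrA ler_wpM2l// le_max lexx orbT.
Qed.

Lemma ex_dual (V : normedModType R) (f : V -> R) (M : R) :
  linear (f : V -> R^o) -> (forall x, f x <= M * `|x|) ->
  exists F : dual V, forall x, F x = f x.
Proof.
move=> lf fM.
pose f' : {linear V -> R^o} :=
  HB.pack (f : V -> R^o) (GRing.isLinear.Build R V R^o *:%R (f : V -> R^o) lf).
have cf : continuous (f : V -> R^o).
  apply: (@bounded_linear_continuous _ _ _ f'); apply/linear_boundedP.
  exists M; split; first exact: num_real.
  move=> r Mr x; apply: (@le_trans _ _ (M * `|x|)); last first.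
    by rewrite ler_wpM2r// ltW.
  rewrite ler_norml fM andbT; have := fM (- x).
  have -> : f (- x) = - f x by exact: (@linearN _ _ _ _ f').
  by rewrite normrN lerNl.
by exists (Dual (introT (dual_predP (f : V -> R^o)) (conj lf cf))).
Qed.

Lemma dualDE (V : normedModType R) (f g : dual V) x : (f + g) x = f x + g x :> R.
Proof. by []. Qed.

Lemma dualNE (V : normedModType R) (f : dual V) x : (- f) x = - f x :> R.
Proof. by []. Qed.

Lemma dualZE (V : normedModType R) a (f : dual V) x : (a *: f) x = a * f x :> R.
Proof. by []. Qed.

Lemma dual0E (V : normedModType R) x : (0 : dual V) x = 0 :> R.
Proof. by []. Qed.

Lemma dual_ext (V : normedModType R) (f g : dual V) : (forall x, f x = g x) -> f = g.
Proof. by move=> fg; apply: val_inj; apply/funext. Qed.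

Lemma dualD (V : normedModType R) (f : dual V) x y : f (x + y) = f x + f y :> R.
Proof. exact: linearD. Qed.

Lemma dualN (V : normedModType R) (f : dual V) x : f (- x) = - f x :> R.
Proof. exact: linearN. Qed.

Lemma dualZ (V : normedModType R) (f : dual V) a x : f (a *: x) = a * f x :> R.
Proof. exact: linearZ. Qed.

Lemma dual0 (V : normedModType R) (f : dual V) : f 0 = 0 :> R.
Proof. exact: linear0. Qed.

Section EquivalentNorm.
Context {V : normedModType R} (q : V -> R).
Hypothesis nq : equivalent_norm q.
Let sq := equivalent_norm_seminorm nq.

Lemma equivalent_norm_gt0 x : x != 0 -> 0 < q x.
Proof.
move=> x0; rewrite lt_neqAle seminorm_ge0// andbT eq_sym.
by have [_ _ q0 _] := nq; apply: contraNneq x0 => /q0 ->.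
Qed.

Lemma equivalent_norm_unit x : x != 0 -> q ((q x)^-1 *: x) = 1.
Proof.
move=> /equivalent_norm_gt0 qx; have [_ -> _ _] := nq.
by rewrite gtr0_norm ?invr_gt0// mulVf// gt_eqF.
Qed.

Lemma dual_equivalent_bound (f : dual V) :
  exists2 M, 0 <= M & forall x, `|f x| <= M * q x.
Proof.
have [M M0 fM] := dual_bound f; have [_ _ _ [m [M' [m0 qm]]]] := nq.
exists (M / m) => [|x]; first by rewrite divr_ge0// ltW.
apply: (le_trans (fM x)); rewrite -mulrA ler_wpM2l//.
by rewrite ler_pdivlMl//; have /andP[] := qm x.
Qed.

Let dn_has_sup (f : dual V) : has_sup [set `|f x| | x in [set x | q x <= 1]].
Proof.
split; first by exists `|f 0|, 0; rewrite //= seminorm0// ler01.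
have [M M0 fM] := dual_equivalent_bound f; exists M => _ [x /= x1 <-].
by apply: (le_trans (fM x)); rewrite ler_piMr.
Qed.

Lemma dual_norm_ge (f : dual V) x : q x <= 1 -> `|f x| <= dual_norm q f.
Proof. by move=> x1; apply: ub_le_sup; [exact: (dn_has_sup f).2|exists x]. Qed.

Lemma dual_norm_le (f : dual V) x : `|f x| <= dual_norm q f * q x.
Proof.
have [->|x0] := eqVneq x 0; first by rewrite dual0 normr0 seminorm0// mulr0.
have qx := equivalent_norm_gt0 x0.
rewrite -ler_pdivrMr// mulrC -[X in X * _]gtr0_norm ?invr_gt0//.
by rewrite -normrM -dualZ dual_norm_ge// equivalent_norm_unit.
Qed.

Lemma dual_norm_ub (f : dual V) M :
  (forall x, q x <= 1 -> `|f x| <= M) -> dual_norm q f <= M.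
Proof.
by move=> fM; apply: ge_sup => [|_ [x /= x1 <-]]; [exact: (dn_has_sup f).1|exact: fM].
Qed.

Lemma dual_norm_le1 (f : dual V) : (forall x, f x <= q x) -> dual_norm q f <= 1.
Proof.
move=> fq; apply: dual_norm_ub => x x1; rewrite ler_norml.
have := fq x; have := fq (- x); rewrite dualN seminormN//; lra.
Qed.

Lemma le1_dual_norm (f : dual V) : dual_norm q f <= 1 -> forall x, f x <= q x.
Proof.
move=> f1 x; apply: le_trans (ler_norm _) _; apply: le_trans (dual_norm_le f x) _.
by rewrite ler_piMl// seminorm_ge0.
Qed.

Lemma dual_norm_gt (f : dual V) (k : R) : k < dual_norm q f ->
  exists2 x, q x <= 1 & k < f x.
Proof.
move=> kf; apply/not_exists2P => h.
suff : dual_norm q f <= k by rewrite leNgt kf.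
apply: dual_norm_ub => x x1; rewrite ler_norml.
have fk y : q y <= 1 -> f y <= k.
  by move=> y1; have [//|/negP] := h y; rewrite -leNgt.
have := fk x x1; have := fk (- x); rewrite seminormN// dualN => /(_ x1); lra.
Qed.

Lemma dual_norm_seminorm : seminorm (dual_norm q).
Proof.
have leZ a f : dual_norm q (a *: f) <= `|a| * dual_norm q f.
  apply: dual_norm_ub => x x1.
  by rewrite dualZE normrM ler_wpM2l// dual_norm_ge.
split=> [f g|a f].
- apply: dual_norm_ub => x x1; rewrite dualDE (le_trans (ler_normD _ _))//.
  by rewrite lerD// dual_norm_ge.
- have [->|a0] := eqVneq a 0.
    rewrite scale0r normr0 mul0r; apply/eqP; rewrite eq_le; apply/andP; split.
      by apply: dual_norm_ub => x _; rewrite dual0E normr0.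
    by apply: le_trans (dual_norm_ge 0 (x := 0) _) => //; rewrite seminorm0.
  apply/eqP; rewrite eq_le leZ/= -ler_pdivlMl ?normr_gt0//.
  rewrite -normfV; apply: le_trans (leZ _ _).
  by rewrite scalerA mulVf// scale1r.
Qed.

Lemma dual_norm_attained (f : dual V) x : q x = 1 -> `|f x| = dual_norm q f ->
  exists2 y, q y = 1 & f y = dual_norm q f.
Proof.
move=> x1 fx; have [fx0|fx0] := leP 0 (f x); first by exists x => //; rewrite -fx ger0_norm.
by exists (- x); [rewrite seminormN|rewrite dualN -fx ltr0_norm].
Qed.

(** Slices must be entered at unit vectors. For [k >= 0], normalizing a point of the ball only
    increases [f]; for [k < 0], any unit vector with positive value will do, or the normalized [x0]
    if [f = 0]. *)
Lemma sphere_gt (f : dual V) (k : R) (x0 : V) : x0 != 0 -> (f = 0 -> k < 0) ->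
  (exists2 x, q x <= 1 & k < f x) -> exists2 x, q x = 1 & k < f x.
Proof.
move=> x00 f0k [x x1 kx].
have unitE y : y != 0 -> q ((q y)^-1 *: y) = 1 by exact: equivalent_norm_unit.
have [f0|/eqP f0] := eqVneq f 0.
  by exists ((q x0)^-1 *: x0); rewrite ?unitE// f0 dual0E f0k.
have [y fy] : exists y, 0 < f y.
  apply/not_existsP => f_le0; apply: f0; apply: dual_ext => y.
  have := f_le0 y; have := f_le0 (- y); rewrite dualN dual0E => /negP h1 /negP h2.
  by move: h1 h2; rewrite -!leNgt; lra.
have [k0|k0] := ltP k 0.
  have y0 : y != 0 by apply: contraTneq fy => ->; rewrite dual0 ltxx.
  exists ((q y)^-1 *: y); rewrite ?unitE// dualZ.
  apply: lt_trans k0 _.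
  by rewrite mulr_gt0// invr_gt0 equivalent_norm_gt0.
have fx0 : 0 < f x by exact: le_lt_trans k0 kx.
have x0' : x != 0 by apply: contraTneq fx0 => ->; rewrite dual0 ltxx.
exists ((q x)^-1 *: x); rewrite ?unitE// dualZ; apply: lt_le_trans kx _.
by apply: ler_peMl; [exact: ltW|rewrite invf_ge1// equivalent_norm_gt0].
Qed.

End EquivalentNorm.

Lemma norm_dual_le (V : normedModType R) (f : dual V) x : `|f x| <= `|f| * `|x|.
Proof. exact: dual_norm_le (norm_equivalent_norm V) f x. Qed.

Lemma dual_norm_equivalent (V : normedModType R) (q : V -> R) :
  equivalent_norm q -> equivalent_norm (dual_norm q).
Proof.
move=> nq; have [dD dZ] := dual_norm_seminorm nq; split=> // [f f0|].
  apply: dual_ext => x; apply/eqP; rewrite dual0E -normr_le0.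
  by have := dual_norm_le nq f x; rewrite f0 mul0r.
have [_ _ _ [m [M [m0 qmM]]]] := nq.
have M0 : 0 < Num.max M 1 by rewrite lt_max ltr01 orbT.
exists (Num.max M 1)^-1, m^-1; split=> [|f]; first by rewrite invr_gt0.
apply/andP; split.
- rewrite ler_pdivrMl//; apply: (dual_norm_ub (norm_equivalent_norm V)) => x x1.
  apply: le_trans (dual_norm_le nq f x) _; rewrite mulrC ler_wpM2r//.
    by rewrite seminorm_ge0//; exact: dual_norm_seminorm.
  have /andP[_ h] := qmM x; apply: (le_trans h).
  apply: (@le_trans _ _ (Num.max M 1 * `|x|)); first by rewrite ler_wpM2r// le_max lexx.
  by rewrite ler_piMr// ltW.
- apply: (dual_norm_ub nq) => x x1; apply: le_trans (norm_dual_le f x) _.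
  rewrite mulrC ler_wpM2r// -[m^-1]mulr1 ler_pdivlMl//.
  by have /andP[h _] := qmM x; exact: le_trans h x1.
Qed.

End DualNorm.

(** * Strict convexity and smoothness *)

Section Convexity.
Context {R : realType}.

(** By homogeneity only [v x = 1] matters. There [g] must lie between all [f x - q x] and all
    [f y + q y]; these bounds are compatible with each other, because [v (x - y) = 0], and with
    [[- r, r]]. *)
Lemma subtract_seminorm (V : normedModType R) (q : V -> R) (f v : dual V) (r : R) :
  seminorm q -> 0 <= r -> (forall x, f x <= q x + r * `|v x|) ->
  exists2 g, `|g| <= r & forall x, f x - g * v x <= q x.
Proof.
move=> sq r0 fqr; have [qD qZ] := sq.
have [v0|/existsNP[x0 /eqP vx0]] := pselect (forall x, v x = 0).
  by exists 0 => [|x]; [rewrite normr0|have := fqr x; rewrite v0 normr0; lra].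
pose A := [set f x - q x | x in [set x | v x = 1]].
have Aub M : (forall x, v x = 1 -> f x - q x <= M) -> sup A <= M.
  move=> AM; apply: ge_sup; last by move=> _ [x /= vx <-]; exact: AM.
  exists (f ((v x0 : R)^-1 *: x0) - q ((v x0 : R)^-1 *: x0)), ((v x0 : R)^-1 *: x0) => //=.
  by rewrite dualZ mulVf.
have Ale x : v x = 1 -> f x - q x <= sup A.
  move=> vx; apply: ub_le_sup; last by exists x.
  by exists r => _ [y /= vy <-]; have := fqr y; rewrite vy normr1; lra.
have Ar : sup A <= r.
  by apply: Aub => x vx; have := fqr x; rewrite vx normr1; lra.
have Aopp y : v y = 1 -> sup A <= f y + q y.
  move=> vy; apply: Aub => x vx.
  have := fqr (x - y); rewrite dualD dualN (dualD v) dualN vx vy subrr normr0.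
  by have := qD x (- y); rewrite seminormN//; lra.
pose g := Num.max (sup A) (- r).
have g1 y : v y = 1 -> f y - q y <= g <= f y + q y.
  move=> vy; rewrite le_max Ale//= ge_max Aopp//=.
  by have := fqr (- y); rewrite !dualN vy normrN1 seminormN//; lra.
exists g => [|x]; first by rewrite ler_norml le_max lexx orbT ge_max Ar/=; lra.
have [vx|vx|vx] := ltgtP (v x : R) 0.
- have vxn0 : v x != 0 by rewrite lt_eqF.
  have := g1 ((v x : R)^-1 *: x); rewrite dualZ mulVf// => /(_ erefl) /andP[_].
  rewrite -(ler_nM2r vx) mulrDl dualZ qZ ltr0_norm ?invr_lt0//.
  by rewrite mulrAC mulVf// !mulNr mulrAC mulVf//; lra.
- have vxn0 : v x != 0 by rewrite gt_eqF.
  have := g1 ((v x : R)^-1 *: x); rewrite dualZ mulVf// => /(_ erefl) /andP[+ _].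
  rewrite -(ler_pM2r vx) mulrBl dualZ qZ gtr0_norm ?invr_gt0//.
  by rewrite mulrAC mulVf// mulrAC mulVf//; lra.
- by have := fqr x; rewrite vx normr0; lra.
Qed.

Lemma add_norm_le (a b d : R) : `|a + b| <= d -> `|a - b| <= d -> `|a| + `|b| <= d.
Proof.
rewrite !ler_norml => /andP[h1 h2] /andP[h3 h4].
by have [a0|a0] := ger0P a; have [b0|b0] := ger0P b; lra.
Qed.

Lemma norm_add_lt (a b : R) : a * b < 0 -> `|a + b| < `|a| + `|b|.
Proof.
rewrite ltr_norml => ab; apply/andP.
by have [a0|a0] := ger0P a; have [b0|b0] := ger0P b; split; nra.
Qed.

(** The dual ball of [p] is the sum of the dual ball of [q] and the segment from [- r *: v] to
    [r *: v], and suprema of [F] over a sum of sets add up. *)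
Lemma bidual_normD (V : normedModType R) (p q : V -> R) (v : dual V) (r : R) :
  equivalent_norm p -> equivalent_norm q -> 0 <= r ->
  (forall x, p x = q x + r * `|v x|) ->
  forall F : dual (dual V),
    dual_norm (dual_norm p) F = dual_norm (dual_norm q) F + r * `|F v|.
Proof.
move=> np nq r0 pE F.
have sq := equivalent_norm_seminorm nq.
have ndp := dual_norm_equivalent np; have ndq := dual_norm_equivalent nq.
apply/eqP; rewrite eq_le; apply/andP; split.
- apply: (dual_norm_ub ndp) => f /(le1_dual_norm np) fp.
  have fqr x : f x <= q x + r * `|v x| by rewrite -pE.
  have [g gr fg] := subtract_seminorm sq r0 fqr.
  have -> : f = (f - g *: v) + g *: v by rewrite subrK.
  rewrite dualD (le_trans (ler_normD _ _))// lerD//.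
    apply: (dual_norm_ge ndq F); apply: dual_norm_le1 => // x.
  by rewrite dualZ normrM ler_wpM2r.
- rewrite -lerBrDr; apply: (dual_norm_ub ndq) => f fq; rewrite lerBrDr.
  have pm (s : R) : `|s| <= 1 -> dual_norm p (f + (s * r) *: v) <= 1.
    move=> s1; apply: (dual_norm_le1 np) => x.
    rewrite dualDE dualZE pE lerD//; first exact: (le1_dual_norm nq).
    apply: le_trans (ler_norm _) _; rewrite !normrM (ger0_norm r0) -mulrA.
    by rewrite ler_piMl// mulr_ge0.
  have Fpm s : `|s| <= 1 -> `|F f + s * r * F v| <= dual_norm (dual_norm p) F.
    by move=> s1; rewrite -dualZ -dualD; exact: (dual_norm_ge ndp F (pm s s1)).
  rewrite -[X in X * _](ger0_norm r0) -normrM; apply: add_norm_le.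
  + by have := Fpm 1; rewrite normr1 mul1r; apply.
  + by have := Fpm (-1); rewrite normrN1 mulN1r mulNr; apply.
Qed.

(** Opposite signs make the triangle inequality strict for [r * |v|], hence for [Q], while a segment
    in the sphere forces equality. Here [v] is only a function, so that it can be a functional on
    [V] or an evaluation on the bidual. *)
Lemma strictly_convex_sum (V : normedModType R) (Q : V -> R) : equivalent_norm Q ->
  (forall x y, x != 0 -> (forall a, y <> a *: x) ->
    exists (Q' : V -> R) (r : R) (v : V -> R),
    [/\ forall z, Q z = Q' z + r * `|v z|, seminorm Q', 0 < r,
        v (x + y) = v x + v y & v x * v y < 0]) ->
  strictly_convex Q.
Proof.
move=> nQ ex x y xy sxy; have sQ := equivalent_norm_seminorm nQ.
have [_ QZ] := sQ.
have Qx : Q x = 1.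
  by apply: sxy; exists 0; rewrite /= ?in_itv/= ?lexx ?ler01// subr0 scale1r scale0r addr0.
have Qy : Q y = 1.
  by apply: sxy; exists 1; rewrite /= ?in_itv/= ?lexx ?ler01// subrr scale1r scale0r add0r.
have Qxy : Q (x + y) = 2.
  have : Q ((1 / 2) *: (x + y)) = 1.
    apply: sxy; exists (1 / 2); first by rewrite /= in_itv/=; lra.
    by rewrite scalerDr; congr (_ *: _ + _); lra.
  by rewrite QZ ger0_norm; lra.
have [[a ya]|] := pselect (exists a, y = a *: x).
  move: Qxy xy Qy; rewrite ya QZ Qx mulr1 => + + a1.
  have [a0|a0] := leP 0 a.
    by move=> _; rewrite -(ger0_norm a0) a1 scale1r eqxx.
  have -> : a = -1 by move: a1; rewrite ltr0_norm//; lra.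
  by rewrite scaleN1r subrr (seminorm0 sQ) => /eqP; rewrite eq_sym pnatr_eq0.
move=> /forallNP yx.
have x0 : x != 0.
  by apply: contra_eqN Qx => /eqP ->; rewrite (seminorm0 sQ) eq_sym oner_eq0.
have [Q' [r [v [QE [Q'D _] r0 vD vxy]]]] := ex x y x0 yx.
have := norm_add_lt vxy.
have := Q'D x y; move: Qxy Qx Qy; rewrite !QE vD.
by nra.
Qed.

(** * Smoothness from strict convexity of the dual norm *)

Section Smooth.
Context (V : normedModType R) (q : V -> R).
Hypotheses (nq : equivalent_norm q) (scq : strictly_convex (dual_norm q)).
Let sq := equivalent_norm_seminorm nq.

Let supports (x : V) (F : dual V) := (forall z, F z <= q z) /\ q x <= F x.

Let supports_norm x F : x != 0 -> supports x F -> dual_norm q F = 1.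
Proof.
move=> x0 [Fq qF]; apply/eqP; rewrite eq_le dual_norm_le1//=.
have qx : 0 < q x by exact: equivalent_norm_gt0.
rewrite -(ler_pM2r qx) mul1r; apply: (le_trans qF).
exact: le_trans (ler_norm _) (dual_norm_le nq F x).
Qed.

(** The segment between two functionals supporting at [x] consists of such functionals, so it lies
    in the dual sphere. *)
Let supports_uniq x F G : x != 0 -> supports x F -> supports x G -> F = G.
Proof.
move=> x0 sF sG; apply/eqP/negP => /negP FG; apply: (scq FG).
move=> _ [t /= + <-]; rewrite in_itv/= => /andP[t0 t1].
apply: (supports_norm x0); move: sF sG => [Fq qF] [Gq qG].
by split=> [z|]; rewrite dualDE !dualZE; [have := Fq z; have := Gq z|]; nra.
Qed.

(** The constraints [F x >= q x] and [F h >= d] generate a cone; by homogeneity, its compatibility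
    with [q] reduces to the assumed slope bound along [h]. *)
Let ex_supports x h d : (forall t, 0 < t -> t * d <= q (x + t *: h) - q x) ->
  exists2 F, supports x F & d <= F h.
Proof.
move=> qd; have [qD qZ] := sq.
have dh : d <= q h.
  have := qd 1 ltr01; rewrite mul1r scale1r; have := qD x h; lra.
pose G z c := exists s t : R, [/\ 0 <= s, 0 <= t, z = - (s *: x + t *: h) &
  c = - (s * q x + t * d)].
have cG : convex_cone G.
  split=> [|_ _ _ _ [s [t [s0 t0 -> ->]]] [s' [t' [s0' t0' -> ->]]]
           |a _ _ a0 [s [t [s0 t0 -> ->]]]].
  - by exists 0, 0; split=> //; rewrite ?scale0r ?mul0r addr0 oppr0.
  - exists (s + s'), (t + t'); split; rewrite ?addr_ge0//; last by lra.
    by rewrite -opprD; congr (- _); rewrite !scalerDl addrACA.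
  - exists (a * s), (a * t); split; [by rewrite mulr_ge0// ltW|by rewrite mulr_ge0// ltW| |by lra].
    by rewrite scalerN scalerDr !scalerA.
have qG z c : G z c -> - c <= q (- z).
  move=> [s [t [s0 t0 -> ->]]]; rewrite !opprK.
  move: s0 t0; rewrite le_eqVlt => /predU1P[<-|s0].
    rewrite mul0r scale0r !add0r qZ => t0; rewrite ger0_norm//; nra.
  rewrite le_eqVlt => /predU1P[<-|t0].
    by rewrite mul0r scale0r !addr0 qZ gtr0_norm.
  have -> : s *: x + t *: h = s *: (x + (t / s) *: h).
    by rewrite scalerDr scalerA mulrCA divff ?gt_eqF// mulr1.
  rewrite qZ gtr0_norm//; have := qd (t / s) (divr_gt0 t0 s0).
  rewrite -(ler_pM2l s0) mulrA mulrCA divff ?gt_eqF// mulr1; lra.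
have [f [lf fq fG]] := hahn_banach_cone (seminorm_sublinear sq) cG qG.
have [_ _ _ [m [M [m0 qM]]]] := nq.
have [|F FE] := @ex_dual R V f M lf; first by move=> z; have := qM z; have := fq z; lra.
have FG z c : G z c -> F z <= c by rewrite FE; exact: fG.
exists F; first split.
- by move=> z; rewrite FE.
- have := FG (- x) (- q x); rewrite dualN lerN2; apply.
  by exists 1, 0; rewrite scale1r scale0r addr0 mul1r mul0r addr0.
- have := FG (- h) (- d); rewrite dualN lerN2; apply.
  by exists 0, 1; rewrite scale1r scale0r add0r mul1r mul0r add0r.
Qed.

(** Two-sided difference quotients squeeze: below by the unique supporting
    functional [D], above because a larger one-sided derivative would give,
    by Hahn-Banach, a second supporting functional. *)
Lemma smooth_of_strictly_convex_dual : smooth q.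
Proof.
move=> x x0; have [qD qZ] := sq.
have [|D sD _] := @ex_supports x 0 0.
  by move=> t _; rewrite scaler0 mulr0 addr0 subrr.
have [Dq qDx] := sD.
have lower h t : t * D h <= q (x + t *: h) - q x.
  by have := Dq (x + t *: h); rewrite dualD dualZ; lra.
have upper h e : 0 < e -> exists2 t0, 0 < t0 &
    forall t, 0 < t -> t <= t0 -> q (x + t *: h) - q x <= t * (D h + e).
  move=> e0; have [t0 [t00 qt0]] : exists t0, 0 < t0 /\
      q (x + t0 *: h) - q x < t0 * (D h + e).
    apply/not_existsP => hn; have [|F sF] := @ex_supports x h (D h + e).
      by move=> t t0; rewrite leNgt; apply/negP => ht; apply: (hn t).
    by rewrite (supports_uniq x0 sF sD); lra.
  exists t0 => // t t_gt0 tt0.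
  (* By convexity the difference quotient at [t] is at most the one at [t0]. *)
  have -> : x + t *: h = (1 - t / t0) *: x + (t / t0) *: (x + t0 *: h).
    rewrite scalerDr addrA -scalerDl subrK scale1r scalerA.
    by rewrite -mulrA mulVf ?gt_eqF// mulr1.
  have u0 : 0 < t / t0 by exact: divr_gt0.
  have u1 : t / t0 <= 1 by rewrite ler_pdivrMr// mul1r.
  have := qD ((1 - t / t0) *: x) ((t / t0) *: (x + t0 *: h)).
  rewrite !qZ (gtr0_norm u0) ger0_norm ?subr_ge0//.
  have : t / t0 * (q (x + t0 *: h) - q x) <= t / t0 * (t0 * (D h + e)).
    by rewrite ler_pM2l// ltW.
  by rewrite !mulrA divfK ?gt_eqF//; nra.
exists D => h.
have cv : (fun t : R => t^-1 *: (((q : V -> R^o) \o shift x) (t *: h) - (q : V -> R^o) x)) @ 0^'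
    --> (D h : R^o).
  apply/cvgrPdist_le => e e0.
  have [t0 t00 ut] := upper h _ e0; have [t1 t10 ut'] := upper (- h) _ e0.
  exists (Num.min t0 t1) => /=; first by rewrite lt_min t00.
  move=> t /=; rewrite sub0r normrN lt_min => /andP[tt0 tt1] tn0.
  rewrite /= (addrC _ x).
  change (`|(D h : R) - t^-1 * (q (x + t *: h) - q x)| <= e).
  have := lower h t.
  have [t_gt0|t_lt0|] := ltgtP 0 t; last by move/eqP; rewrite eq_sym (negPf tn0).
  - have := ut t t_gt0; rewrite -(gtr0_norm t_gt0) => /(_ (ltW tt0)).
    rewrite (gtr0_norm t_gt0) ler_norml => h1 h2.
    have : D h <= t^-1 * (q (x + t *: h) - q x) by rewrite ler_pdivlMl.
    have : t^-1 * (q (x + t *: h) - q x) <= D h + e by rewrite ler_pdivrMl.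
    by move=> ? ?; apply/andP; split; lra.
  - have := ut' (- t); rewrite oppr_gt0 => /(_ t_lt0).
    rewrite -(ltr0_norm t_lt0) => /(_ (ltW tt1)).
    rewrite (ltr0_norm t_lt0) scalerN scaleNr opprK dualN ler_norml mulNr => h1 h2.
    have : D h - e <= t^-1 * (q (x + t *: h) - q x).
      by rewrite ler_ndivlMl//; lra.
    have : t^-1 * (q (x + t *: h) - q x) <= D h by rewrite ler_ndivrMl.
    by move=> ? ?; apply/andP; split; lra.
split; first by apply/cvg_ex; exists (D h).
exact: cvg_lim.
Qed.

End Smooth.
End Convexity.

(** * Integer combinations of a sequence of functionals *)

Lemma eventually_forall_ltn (P : nat -> nat -> Prop) (k : nat) :
  (forall i, (i < k)%N -> exists N, forall n, (N <= n)%N -> P i n) ->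
  exists N, forall i n, (i < k)%N -> (N <= n)%N -> P i n.
Proof.
elim: k => [_|k IH Pk]; first by exists 0%N.
have [|N PN] := IH; first by move=> i ik; apply: Pk; rewrite ltnS ltnW.
have [N' PN'] := Pk k (ltnSn k).
exists (maxn N N') => i n; rewrite ltnS leq_eqVlt geq_max => /predU1P[->|ik] /andP[Nn N'n].
  exact: PN'.
exact: PN.
Qed.

Lemma injective_unbounded (h : nat -> nat) : injective h ->
  forall N, exists k, (N <= h k)%N.
Proof.
move=> hinj N; apply/not_existsP => hN.
have hlt k : (h k < N)%N by rewrite ltnNge; apply/negP.
have inj : injective (fun i : 'I_N.+1 => Ordinal (hlt i)).
  by move=> i j /(congr1 val)/= /hinj/val_inj.
by have := leq_card _ inj; rewrite !card_ord ltnn.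
Qed.

Section IntegerCombinations.
Context {R : realType} {X : normedModType R} (ys : nat -> dual X).

(** Integer coefficients keep the combinations countable and still reach every open sector of the
    plane of values of two independent forms. *)
Definition int_comb (l : seq (nat * int)) : dual X :=
  \sum_(i <- l) i.2%:~R *: ys i.1.

Definition int_scale (k : int) (l : seq (nat * int)) : seq (nat * int) :=
  [seq (i.1, k * i.2) | i <- l].

Implicit Types phi psi : dual X -> R.

(** Covers evaluations at points of [X] as well as elements of the bidual, so that the norm and its
    bidual norm share the same lemmas. *)
Definition form phi : Prop := linear (phi : dual X -> R^o).

Lemma formD phi f g : form phi -> phi (f + g) = phi f + phi g.
Proof. by move=> lphi; have := lphi 1 f g; rewrite !scale1r. Qed.

Lemma form0 phi : form phi -> phi 0 = 0.
Proof. by move=> lphi; have := formD 0 0 lphi; rewrite addr0; lra. Qed.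

Lemma formZ phi a f : form phi -> phi (a *: f) = a * phi f.
Proof. by move=> lphi; have := lphi a f 0; rewrite (form0 lphi) !addr0. Qed.

Lemma int_comb_cat phi l l' : form phi ->
  phi (int_comb (l ++ l')) = phi (int_comb l) + phi (int_comb l').
Proof. by move=> lphi; rewrite -formD// /int_comb big_cat. Qed.

Lemma int_comb_scale phi k l : form phi ->
  phi (int_comb (int_scale k l)) = k%:~R * phi (int_comb l).
Proof.
move=> lphi; rewrite -formZ// /int_comb /int_scale big_map scaler_sumr.
by congr phi; apply: eq_bigr => i _; rewrite scalerA intrM.
Qed.

Lemma int_comb1 phi j k : form phi -> phi (int_comb [:: (j, k)]) = k%:~R * phi (ys j).
Proof. by move=> lphi; rewrite -formZ// /int_comb big_seq1. Qed.

(** A large multiple of a combination good for the earlier forms absorbs the addition of one [ys j],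
    which repairs the last form. *)
Lemma int_comb_neq0 (phi : nat -> dual X -> R) k :
  (forall i, (i < k)%N -> form (phi i) /\ exists j, phi i (ys j) != 0) ->
  exists l, forall i, (i < k)%N -> phi i (int_comb l) != 0.
Proof.
elim: k => [_|k IH phik]; first by exists [::].
have [|l lP] := IH; first by move=> i ik; apply: phik; rewrite ltnS ltnW.
have [lk [j jk]] := phik k (ltnSn k).
have [phil|phil] := eqVneq (phi k (int_comb l)) 0; last first.
  by exists l => i; rewrite ltnS leq_eqVlt => /predU1P[->|/lP].
have [M MP] : exists M : nat, forall i m, (i < k)%N -> (M <= m)%N ->
    `|phi i (ys j)| < m%:R * `|phi i (int_comb l)|.
  apply: eventually_forall_ltn => i ik.
  have := lP i ik; rewrite -normr_gt0 => li.
  exists (Num.bound (`|phi i (ys j)| / `|phi i (int_comb l)|)) => m bm.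
  rewrite -ltr_pdivrMr//; apply: lt_le_trans (archi_boundP _) _.
    by rewrite divr_ge0.
  by rewrite ler_nat.
exists (int_scale M l ++ [:: (j, 1)]) => i ik1; have [li _] := phik i ik1.
rewrite int_comb_cat// int_comb_scale// int_comb1// mul1r.
move: ik1; rewrite ltnS leq_eqVlt => /predU1P[->|ik].
  by rewrite phil mulr0 add0r.
have := MP i M ik (leqnn M); apply: contraTneq => /eqP; rewrite addr_eq0 => /eqP e.
by rewrite -leNgt -[X in _ <= X]normrN -e normrM normr_nat.
Qed.

(** Integer combinations follow the direction [(1, -1)] of the plane of values
    of [(phi, psi)] up to a bounded error. *)
Lemma int_comb_opposite phi psi : form phi -> form psi ->
  (exists j, phi (ys j) != 0) ->
  (forall a, exists j, psi (ys j) != a * phi (ys j)) ->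
  exists l, 0 < phi (int_comb l) /\ psi (int_comb l) < 0.
Proof.
move=> lphi lpsi [i phi_i] indep.
have [j] := indep (psi (ys i) / phi (ys i)).
set a1 := phi (ys i); set a2 := phi (ys j); set b1 := psi (ys i); set b2 := psi (ys j).
move=> det; have {}det : a1 * b2 - a2 * b1 != 0.
  apply: contra_neq det => det0; apply: (mulIf phi_i); rewrite -/a1.
  by rewrite mulrAC divfK//; lra.
set d := a1 * b2 - a2 * b1 in det.
(* Cramer's rule for the real combination with values [1] and [-1]. *)
pose A := (b2 + a2) / d; pose B := - (b1 + a1) / d.
have A1 : A * a1 + B * a2 = 1 by rewrite /A /B /d; field.
have B1 : A * b1 + B * b2 = -1 by rewrite /A /B /d; field.
(* After scaling by [K], rounding the coefficients down costs less than [K], so the signs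
   survive. *)
pose K : R := (Num.bound (`|a1| + `|a2| + `|b1| + `|b2|))%:R.
have K0 : `|a1| + `|a2| + `|b1| + `|b2| < K.
  by apply: archi_boundP; rewrite !addr_ge0.
pose m := Num.floor (K * A); pose n := Num.floor (K * B).
have [m0 m1] : 0 <= K * A - m%:~R /\ K * A - m%:~R <= 1.
  by have := floor_le (K * A); have := floorD1_gt (K * A); rewrite -/m intrD; split; lra.
have [n0 n1] : 0 <= K * B - n%:~R /\ K * B - n%:~R <= 1.
  by have := floor_le (K * B); have := floorD1_gt (K * B); rewrite -/n intrD; split; lra.
have err (t c : R) : 0 <= t -> t <= 1 -> - `|c| <= t * c <= `|c|.
  by move=> t0 t1; rewrite -ler_norml normrM ger0_norm// ler_piMl.
exists ([:: (i, m)] ++ [:: (j, n)]); rewrite !int_comb_cat// !int_comb1//.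
rewrite -/a1 -/a2 -/b1 -/b2.
have Ea : m%:~R * a1 + n%:~R * a2 = K - (K * A - m%:~R) * a1 - (K * B - n%:~R) * a2.
  by rewrite -[X in X - _ - _](mulr1 K) -A1; ring.
have Eb : m%:~R * b1 + n%:~R * b2 = - K - (K * A - m%:~R) * b1 - (K * B - n%:~R) * b2.
  by rewrite -[X in X - _ - _]mulrN1 -B1; ring.
rewrite Ea Eb.
have := err _ a1 m0 m1; have := err _ a2 n0 n1.
have := err _ b1 m0 m1; have := err _ b2 n0 n1.
have := normr_ge0 a1; have := normr_ge0 a2; have := normr_ge0 b1; have := normr_ge0 b2.
by move=> ? ? ? ? /andP[? ?] /andP[? ?] /andP[? ?] /andP[? ?]; split; lra.
Qed.

(** Every integer combination of the [ys] occurs, up to a positive factor, at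
    infinitely many indices: the first component of the decoded pair is a
    dummy. *)
Definition int_comb_enum (K : R) (n : nat) : dual X :=
  if (unpickle n : option (nat * seq (nat * int))) is Some (_, l) then
    (K * (1 + `|int_comb l|))^-1 *: int_comb l
  else 0.

(** The denominator in the enumeration is chosen for this bound; its summand [1] keeps it nonzero at
    the zero combination. *)
Lemma int_comb_enum_bound K n x : 0 < K -> `|int_comb_enum K n x| <= K^-1 * `|x|.
Proof.
move=> K0; rewrite /int_comb_enum; case: unpickle => [[k l]|]; last first.
  by rewrite dual0E normr0 mulr_ge0// invr_ge0 ltW.
set f := int_comb l; rewrite dualZE normrM.
have f1 : 0 < 1 + `|f| by rewrite ltr_pwDl.
rewrite gtr0_norm ?invr_gt0 ?mulr_gt0// invfM -mulrA ler_pM2l ?invr_gt0//.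
rewrite ler_pdivrMl//; apply: le_trans (norm_dual_le f x) _.
by rewrite ler_wpM2r// lerDr.
Qed.

Section Perturbation.
Context (K : R) (s : nat -> R) (E : nat -> dual X).
Hypothesis K0 : 0 < K.
Hypothesis s0 : s @ \oo --> (0 : R).

Definition perturbed_enum (n : nat) : dual X := int_comb_enum K n + s n *: E n.

(** The combination recurs at arbitrarily large indices with one fixed factor [c], whereas the
    perturbation [s n * phi i (E n)] tends to zero and finally cannot change the sign. *)
Lemma perturbed_enum_hits (phi : nat -> dual X -> R) k l N :
  (forall i, (i < k)%N -> form (phi i) /\ exists B, forall n, `|phi i (E n)| <= B) ->
  (forall i, (i < k)%N -> phi i (int_comb l) != 0) ->
  exists2 n, (N <= n)%N &
    forall i, (i < k)%N -> 0 < phi i (perturbed_enum n) * phi i (int_comb l).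
Proof.
move=> phiP phil.
have [c [c0 cP]] : exists c, 0 < c /\ forall N, exists2 n, (N <= n)%N &
    int_comb_enum K n = c *: int_comb l.
  exists (K * (1 + `|int_comb l|))^-1; split.
    by rewrite invr_gt0 mulr_gt0// ltr_pwDl.
  move=> M; have [|h Mh] := @injective_unbounded (fun k : nat => pickle (k, l)) _ M.
    by move=> h h' /(pcan_inj pickleK)[].
  by exists (pickle (h, l)); rewrite // /int_comb_enum pickleK.
have [M MP] : exists M, forall i n, (i < k)%N -> (M <= n)%N ->
    `|s n * phi i (E n)| < c * `|phi i (int_comb l)|.
  apply: eventually_forall_ltn => i ik; have [_ [B BP]] := phiP i ik.
  have B0 : 0 <= B by exact: le_trans (normr_ge0 _) (BP 0%N).
  have e0 : 0 < c * `|phi i (int_comb l)| / (1 + B).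
    by rewrite divr_gt0 ?mulr_gt0 ?normr_gt0 ?phil// ltr_pwDl.
  move/cvgrPdist_lt : s0 => /(_ _ e0)[M _ MP]; exists M => n Mn.
  have := MP n Mn; rewrite /= sub0r normrN ltr_pdivlMr ?ltr_pwDl//.
  apply: le_lt_trans; rewrite normrM ler_wpM2l//.
  by apply: le_trans (BP n) _; rewrite lerDr.
have [n] := cP (maxn N M); rewrite geq_max => /andP[Nn Mn] un.
exists n => // i ik; have [lphi _] := phiP i ik.
rewrite /perturbed_enum formD// !formZ// un formZ//.
have := MP i n ik Mn; have := phil i ik.
move: (s n * _) (phi i _) => a b.
by have [b0|b0|//] := ltgtP b 0 => _; rewrite ?(ltr0_norm b0) ?(gtr0_norm b0) ltr_norml => /andP[]; nra.
Qed.

Lemma perturbed_enum_neq0 (phi : nat -> dual X -> R) k N :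
  (forall i, (i < k)%N -> [/\ form (phi i), exists B, forall n, `|phi i (E n)| <= B &
     exists j, phi i (ys j) != 0]) ->
  exists2 n, (N <= n)%N & forall i, (i < k)%N -> phi i (perturbed_enum n) != 0.
Proof.
move=> phiP; have [i ik|l lP] := @int_comb_neq0 phi k.
  by have [] := phiP i ik.
have [i ik|n Nn nP] := @perturbed_enum_hits phi k l N _ lP.
  by have [] := phiP i ik.
by exists n => // i ik; apply: contraTneq (nP i ik) => ->; rewrite mul0r ltxx.
Qed.

Lemma perturbed_enum_opposite phi psi :
  form phi -> (exists B, forall n, `|phi (E n)| <= B) ->
  form psi -> (exists B, forall n, `|psi (E n)| <= B) ->
  (exists j, phi (ys j) != 0) ->
  (forall a, exists j, psi (ys j) != a * phi (ys j)) ->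
  exists n, phi (perturbed_enum n) * psi (perturbed_enum n) < 0.
Proof.
move=> lphi Bphi lpsi Bpsi phi0 indep.
have [l [phil psil]] := int_comb_opposite lphi lpsi phi0 indep.
pose fs i := if i is 0%N then phi else psi.
have [||n _ nP] := @perturbed_enum_hits fs 2 l 0; first by case.
- by case=> [|i] _ /=; [rewrite gt_eqF|rewrite lt_eqF].
exists n; have := nP 0%N isT; have := nP 1%N isT => /=.
by rewrite (nmulr_lgt0 _ psil) (pmulr_lgt0 _ phil) => psin phin; rewrite pmulr_rlt0.
Qed.

End Perturbation.
End IntegerCombinations.

(** * The norm adapted to a copy of c0 *)

Section CZeroSystem.
Context {R : realType}.

Lemma c0_norm_ge (u : c0 R) n : `|u n| <= `|u|.
Proof.
apply: ub_le_sup; last by exists n.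
have /c0_predP u0 := c0_funP u.
have /cvg_seq_bounded[M [_ uM]] : cvgn (u : nat -> R^o) by apply/cvg_ex; exists 0.
by exists (M + 1) => _ [k _ <-]; apply: (uM (M + 1)); rewrite ?ltrDl.
Qed.

Lemma c0_norm_ub (u : c0 R) M : (forall n, `|u n| <= M) -> `|u| <= M.
Proof. by move=> uM; apply: ge_sup => [|_ [n _ <-]//]; exists `|u 0%N|, 0%N. Qed.

Lemma c0_truncation_subproof (u : nat -> R) (N : nat) :
  (fun k => if (k < N)%N then u k else 0) \in @c0_pred R.
Proof.
apply/c0_predP; apply: (@cvg_near_cst _ _ (0 : R^o)).
by exists N => // k /= Nk; rewrite ltnNge Nk.
Qed.

Definition c0_truncation u N : c0 R := C0 (c0_truncation_subproof u N).

Definition c0_unit (n : nat) : c0 R := c0_truncation (fun k => (k == n)%:R) n.+1.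

Lemma c0_unitE n k : c0_unit n k = (k == n)%:R :> R.
Proof.
by rewrite /= ltnS; case: eqVneq => [->|kn]; [rewrite leqnn|case: ifP].
Qed.

Lemma c0_ext (u v : c0 R) : (forall n, u n = v n) -> u = v.
Proof. by move=> uv; apply: val_inj; apply/funext. Qed.

Lemma c0DE (u v : c0 R) n : (u + v) n = u n + v n :> R.
Proof. by []. Qed.

Lemma c0ZE a (u : c0 R) n : (a *: u) n = a * u n :> R.
Proof. by []. Qed.

Lemma c0_truncationS u N :
  c0_truncation u N.+1 = c0_truncation u N + u N *: c0_unit N.
Proof.
apply: c0_ext => k; rewrite c0DE c0ZE c0_unitE /= ltnS leq_eqVlt.
have [->|kN] := eqVneq k N; first by rewrite ltnn/= mulr1 add0r.
by rewrite /= mulr0 addr0.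
Qed.

(** By [c0s_shift], moving along [e n] changes [nu] only through the value of
    [E n]. *)
Record c0_system (X : normedModType R) (e : nat -> X) (E : nat -> dual X)
    (nu : X -> R) : Prop := C0System {
  c0s_biorthogonal : forall n m, E n (e m) = (n == m)%:R :> R;
  c0s_norm : equivalent_norm nu;
  c0s_bound : forall n x, `|E n x| <= nu x;
  c0s_shift : forall n x t, nu (x + t *: e n) <= Num.max (nu x) `|E n x + t|;
  c0s_inactive : forall x, x != 0 -> \forall n \near \oo, `|E n x| < nu x;
  c0s_weakly_null : forall f : dual X, f (e n) @[n --> \oo] --> (0 : R)
}.

Lemma c0_system_subseq (X : normedModType R) e E nu (a : nat -> nat) :
  (forall n, (a n < a n.+1)%N) ->
  @c0_system X e E nu -> @c0_system X (e \o a) (E \o a) nu.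
Proof.
move=> aS [eE nn En es ei e0].
have a_mono : {mono a : m n / (m <= n)%N} by apply: leq_mono; apply: homo_ltn => //; exact: ltn_trans.
have a_ge n : (n <= a n)%N.
  by elim: n => // n IH; exact: leq_ltn_trans IH (aS n).
have a_cvg : a @ \oo --> \oo.
  by move=> A [N _ NA]; exists N => // n Nn; apply: NA; exact: leq_trans Nn (a_ge n).
split=> // [n m|n x|n x t|x x0|f] /=.
- by rewrite eE; congr ((_ : bool)%:R); exact: (inj_eq (incn_inj a_mono)).
- exact: En.
- exact: es.
- exact: a_cvg (ei x x0).
- exact: (cvg_comp _ _ a_cvg (e0 f)).
Qed.

(** * Construction of the system from a copy of c0 *)

Section OfCopy.
Context (X : normedModType R) (T : {linear c0 R -> X}) (m M : R).
Hypotheses (m0 : 0 < m) (TmM : forall y, m * `|y| <= `|T y| <= M * `|y|).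

Let T_ge y : `|y| <= m^-1 * `|T y|.
Proof. by rewrite ler_pdivlMl//; have /andP[] := TmM y. Qed.

(** Hahn-Banach extension of the coordinate from the range of [T]: the cone is the graph of the
    coordinate, and being symmetric it forces equality. *)
Lemma copy_coordinate n : exists E : dual X,
  (forall y, E (T y) = y n) /\ forall x, `|E x| <= m^-1 * `|x|.
Proof.
pose q (x : X) := m^-1 * `|x|.
have im0 : 0 < m^-1 by rewrite invr_gt0.
have sq : seminorm q.
  split=> [x y|a x]; first by rewrite /q -mulrDr ler_pM2l// ler_normD.
  by rewrite /q normrZ mulrCA.
pose G z (c : R) := exists2 y, z = T y & c = y n.
have cG : convex_cone G.
  split=> [|_ _ _ _ [y -> ->] [y' -> ->]|a _ _ a0 [y -> ->]].
  - by exists 0; rewrite ?linear0.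
  - by exists (y + y'); rewrite ?linearD.
  - by exists (a *: y); rewrite ?linearZ.
have [|f [lf fq fG]] := hahn_banach_cone (seminorm_sublinear sq) cG.
  move=> _ _ [y -> ->]; rewrite /q normrN; apply: le_trans (T_ge y).
  by apply: le_trans (c0_norm_ge y n); rewrite -normrN ler_norm.
have [E EE] := ex_dual lf fq; exists E.
have Eq x : E x <= q x by rewrite EE.
split=> [y|x]; last first.
  rewrite ler_norml; apply/andP; split; last exact: Eq.
  by rewrite lerNl -dualN -normrN; exact: Eq.
have Ele z : E (T z) <= z n by rewrite EE; apply: fG; exists z.
apply/eqP; rewrite eq_le Ele/= -lerN2 -dualN -linearN; exact: Ele.
Qed.

(** Testing [f] on truncated sign sequences, of norm at most one, shows that its values on the
    images of the unit vectors are absolutely summable. *)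
Lemma weakly_null_copy (f : dual X) : f (T (c0_unit n)) @[n --> \oo] --> (0 : R).
Proof.
have [B B0 fB] := dual_bound f.
pose g n : R := f (T (c0_unit n)).
have trunc N : f (T (c0_truncation (fun k => Num.sg (g k)) N)) = \sum_(k < N) `|g k| :> R.
  elim: N => [|N IH].
    rewrite big_ord0 (_ : c0_truncation _ 0 = 0) ?linear0 ?dual0//.
    exact: c0_ext.
  by rewrite c0_truncationS linearD linearZ dualD dualZ IH big_ord_recr/= -normrEsg.
have bnd N : \sum_(k < N) `|g k| <= B * M.
  rewrite -trunc; apply: le_trans (ler_norm _) _; apply: le_trans (fB _) _.
  rewrite ler_wpM2l//; have /andP[_] := TmM (c0_truncation (fun k => Num.sg (g k)) N).
  have M0 : 0 <= M.
    have u1 : 1 <= `|c0_unit 0|.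
      by have := c0_norm_ge (c0_unit 0) 0%N; rewrite c0_unitE eqxx normr1.
    have /andP[h1 h2] := TmM (c0_unit 0).
    rewrite -(pmulr_lge0 M (lt_le_trans ltr01 u1)); apply: le_trans h2.
    exact: normr_ge0.
  move=> h; apply: (le_trans h); rewrite ler_piMr//; apply: c0_norm_ub => k /=.
  by case: ifP => _; rewrite ?normr0 ?ler01// normr_sg; case: (_ == _).
have cs : cvgn (series (fun k => `|g k|)).
  apply: nondecreasing_is_cvgn.
    by apply/nondecreasing_seqP => n; rewrite /series/= big_nat_recr//= lerDl.
  by exists (B * M) => _ [n _ <-]; rewrite /series/= big_mkord.
by have := cvg_series_cvg_0 cs; move/norm_cvg0P.
Qed.

Lemma c0_system_of_copy : exists e E nu, @c0_system X e E nu.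
Proof.
have [E EP] := choice copy_coordinate.
have ET n y : E n (T y) = y n by have [] := EP n.
have Ele n x : `|E n x| <= m^-1 * `|x| by have [] := EP n.
have im0 : 0 < m^-1 by rewrite invr_gt0.
pose e n := T (c0_unit n).
(* With value zero on the copy, [lower_sublinear] of the norm is the distance to the copy. *)
pose G z (c : R) := (exists y, z = T y) /\ c = 0.
have cG : convex_cone G.
  split=> [|_ _ _ _ [[y ->] ->] [[y' ->] ->]|a _ _ a0 [[y ->] ->]].
  - by split=> //; exists 0; rewrite linear0.
  - by rewrite addr0; split=> //; exists (y + y'); rewrite linearD.
  - by rewrite mulr0; split=> //; exists (a *: y); rewrite linearZ.
have sn := seminorm_sublinear (equivalent_norm_seminorm (norm_equivalent_norm X)).
have nG z c : G z c -> - c <= `|- z| by move=> [_ ->]; rewrite oppr0.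
pose Q := lower_sublinear (Num.norm : X -> R) G.
have QT x y : Q x <= `|x - T y|.
  have := @lower_sublinear_le _ _ _ _ sn nG x (T y) 0.
  by rewrite addr0; apply; split=> //; exists y.
have Qge x d : (forall y, d <= `|x - T y|) -> d <= Q x.
  move=> dT; apply: (lower_sublinear_ge cG) => _ _ [[y ->] ->].
  by rewrite addr0.
have sQ : seminorm Q.
  apply: sublinear_seminorm; first exact: lower_sublinear_sublinear.
  have Qle x : Q (- x) <= Q x.
    apply: Qge => y; have := QT (- x) (- y).
    by rewrite linearN -opprD normrN.
  by move=> x; apply/eqP; rewrite eq_le Qle/= -{1}[x]opprK Qle.
pose A x := sup (range (fun n => `|E n x|)).
have Aub x d : (forall n, `|E n x| <= d) -> A x <= d.
  by move=> Ed; apply: ge_sup => [|_ [n _ <-]//]; exists `|E 0%N x|, 0%N.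
have Age n x : `|E n x| <= A x.
  apply: ub_le_sup; last by exists n.
  by exists (m^-1 * `|x|) => _ [k _ <-].
have sA : seminorm A.
  have AZ a x : A (a *: x) <= `|a| * A x.
    by apply: Aub => n; rewrite dualZ normrM ler_wpM2l.
  apply: sublinear_seminorm; last first.
    have h x : A (- x) <= A x by apply: Aub => n; rewrite dualN normrN.
    by move=> x; apply/eqP; rewrite eq_le h/= -{1}[x]opprK h.
  split=> [|x y|a x a0].
  - apply/eqP; rewrite eq_le; apply/andP; split.
      by apply: Aub => n; rewrite dual0 normr0.
    by apply: le_trans (Age 0%N 0).
  - by apply: Aub => n; rewrite dualD (le_trans (ler_normD _ _))// lerD.
  - by have := AZ a x; rewrite gtr0_norm.
(* The distance to the copy of [c0] bounds [limsup_n `|E n x|] up to the factor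
   [m^-1]; the factor [2] makes it exceed [`|E n x|] strictly for large [n]. *)
pose K := 2 * m^-1; have K0 : 0 < K by rewrite mulr_gt0.
pose nu x := Num.max (A x) (K * Q x).
have [AD AZ] := sA; have [QD QZ] := sQ.
have nu_sn : seminorm nu.
  split=> [x y|a x]; rewrite /nu.
  - rewrite ge_max; apply/andP; split.
      by apply: (le_trans (AD x y)); rewrite lerD// le_max lexx.
    apply: (@le_trans _ _ (K * Q x + K * Q y)).
      by rewrite -mulrDr ler_pM2l.
    by rewrite lerD// le_max lexx orbT.
  - by rewrite AZ QZ mulrCA maxr_pMr.
have nu_le x : nu x <= K * `|x|.
  rewrite ge_max; apply/andP; split.
    apply: Aub => n; apply: (le_trans (Ele n x)).
    by rewrite ler_wpM2r// /K ler_peMl ?ltW// ltr1n.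
  by rewrite ler_pM2l//; have := QT x 0; rewrite linear0 subr0.
have M_ge0 : 0 <= Num.max M 0 by rewrite le_max lexx orbT.
(* Compare [x] with [T y]: the coordinates give [|y| <= A x + m^-1 * |x - T y|], and [T] multiplies
   norms by at most [M]. *)
pose L := (1 + Num.max M 0 * m^-1) * K^-1 + Num.max M 0.
have le_nu x : `|x| <= L * nu x.
  suff : `|x| - Num.max M 0 * A x <= (1 + Num.max M 0 * m^-1) * Q x.
    have : A x <= nu x by rewrite le_max lexx.
    have : Q x <= K^-1 * nu x by rewrite ler_pdivlMl// le_max lexx orbT.
    move=> /(ler_wpM2l (_ : 0 <= 1 + Num.max M 0 * m^-1)) h1 /(ler_wpM2l M_ge0) h2.
    have := h1 (addr_ge0 ler01 (mulr_ge0 M_ge0 (ltW im0))).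
    rewrite /L; lra.
  rewrite -ler_pdivrMl; last by rewrite ltr_pwDl// mulr_ge0// ltW.
  apply: Qge => y; rewrite ler_pdivrMl; last by rewrite ltr_pwDl// mulr_ge0// ltW.
  have xT : `|x| <= `|x - T y| + `|T y| by have := ler_normD (x - T y) (T y); rewrite subrK.
  have Ty : `|T y| <= Num.max M 0 * `|y|.
    have /andP[_ h] := TmM y; apply: (le_trans h).
    by rewrite ler_wpM2r// le_max lexx.
  have yA : `|y| <= A x + m^-1 * `|x - T y|.
    apply: c0_norm_ub => n; rewrite -ET.
    have -> : E n (T y) = E n x - E n (x - T y) :> R.
      by rewrite dualD dualN; lra.
    by rewrite (le_trans (ler_normB _ _))// lerD.
  have := ler_wpM2l M_ge0 yA; lra.
have L0 : 0 < L.
  rewrite ltr_wpDr// mulr_gt0// ?invr_gt0// ltr_pwDl// mulr_ge0// ltW//.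
have nn : equivalent_norm nu.
  have [nuD nuZ] := nu_sn; split=> // [x nux|].
    by have := le_nu x; rewrite nux mulr0 normr_le0 => /eqP.
  exists L^-1, K; split; first by rewrite invr_gt0.
  by move=> x; rewrite nu_le andbT ler_pdivrMl.
exists e, E, nu; split=> //.
- by move=> n k; rewrite ET c0_unitE.
- by move=> n x; rewrite le_max Age.
- move=> n x t; rewrite ge_max; apply/andP; split.
    apply: Aub => k; rewrite dualD dualZ ET c0_unitE.
    have [->|_] := eqVneq k n; first by rewrite mulr1 le_max lexx orbT.
    by rewrite mulr0 addr0 !le_max Age.
  (* The distance to the copy does not change when [x] moves along [e n]. *)
  rewrite le_max; apply/orP; left; rewrite le_max; apply/orP; right.
  rewrite ler_pM2l//; apply: Qge => y; have := QT (x + t *: e n) (y + t *: c0_unit n).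
  by rewrite linearD linearZ opprD addrACA subrr addr0.
- move=> x x0; have nux : 0 < nu x by exact: equivalent_norm_gt0.
  (* The factor [2] in [K] gives [m^-1 * Q x <= nu x / 2], which leaves room for [3 / 4]; the tail
     of [y] stays below the remaining quarter. *)
  have [y Ty] : exists y, m^-1 * `|x - T y| < 3 / 4 * nu x.
    apply/not_existsP => h; have : nu x * (3 / 4) <= m^-1 * Q x.
      rewrite -ler_pdivrMl ?invr_gt0// invrK; apply: Qge => y.
      by rewrite -ler_pdivlMl//; have := h y; move/negP; rewrite -leNgt mulrC.
    have : K * Q x <= nu x by rewrite le_max lexx orbT.
    by rewrite /K; lra.
  have nu4 : 0 < nu x / 4 by rewrite divr_gt0.
  have /c0_predP/cvgrPdist_lt/(_ _ nu4)[N _ Ny] := c0_funP y.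
  exists N => // n Nn; have := Ny n Nn; rewrite /= sub0r normrN -ET => yn.
  have -> : E n x = E n (x - T y) + E n (T y) :> R by rewrite dualD dualN subrK.
  apply: le_lt_trans (ler_normD _ _) _.
  have := Ele n (x - T y); lra.
- exact: weakly_null_copy.
Qed.

End OfCopy.
End CZeroSystem.

(** * Weighted sums of functionals *)

Section WeightedSum.
Context {R : realType} {X : normedModType R} (v : nat -> dual X) (nu : X -> R).
Hypothesis v_le : forall n x, `|v n x| <= 2 * nu x.

Definition weighted_sum (c : nat -> R) (x : X) : R :=
  limn (series (fun n => c n * `|v n x|)).

Definition summable_weight (C : R) (c : nat -> R) : Prop :=
  (forall n, 0 <= c n) /\ forall N, \sum_(k < N) c k <= C.

(** Deleting a term by a zero weight leaves a weighted sum of the same kind, to which the same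
    lemmas apply. *)
Definition skip_weight (c : nat -> R) (n k : nat) : R := if k == n then 0 else c k.

Lemma skip_summable_weight C c n :
  summable_weight C c -> summable_weight C (skip_weight c n).
Proof.
move=> [c0 cC]; rewrite /skip_weight; split=> [k|N]; first by case: ifP.
by apply: le_trans (cC N); apply: ler_sum => k _; case: ifP.
Qed.

Section Weight.
Variables (C : R) (c : nat -> R).
Hypothesis sc : summable_weight C c.

Let nu_ge0 x : 0 <= nu x.
Proof. by have := v_le 0 x; have := normr_ge0 (v 0%N x); lra. Qed.

Lemma weighted_sum_cvg x : cvgn (series (fun n => c n * `|v n x|)).
Proof.
have [c0 cC] := sc; apply: nondecreasing_is_cvgn.
  by apply/nondecreasing_seqP => n; rewrite /series/= big_nat_recr//= lerDl mulr_ge0.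
exists (C * (2 * nu x)) => _ [N _ <-]; rewrite /series/= big_mkord.
apply: (@le_trans _ _ ((\sum_(k < N) c k) * (2 * nu x))).
  by rewrite mulr_suml; apply: ler_sum => k _; rewrite ler_wpM2l.
by rewrite ler_wpM2r// mulr_ge0.
Qed.

Lemma weighted_sum_le x D :
  (forall N, \sum_(k < N) c k * `|v k x| <= D) -> weighted_sum c x <= D.
Proof.
move=> cD; apply: limr_le; first exact: weighted_sum_cvg.
by apply: nearW => N; rewrite /series/= big_mkord.
Qed.

Lemma weighted_sum_le_norm x : weighted_sum c x <= 2 * C * nu x.
Proof.
have [c0 cC] := sc; apply: weighted_sum_le => N.
apply: (@le_trans _ _ ((\sum_(k < N) c k) * (2 * nu x))).
  by rewrite mulr_suml; apply: ler_sum => k _; rewrite ler_wpM2l.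
by have := ler_wpM2r (mulr_ge0 (ler0n R 2) (nu_ge0 x)) (cC N); lra.
Qed.

Lemma weighted_sum_seminorm : seminorm (weighted_sum c).
Proof.
have [c0 cC] := sc; split=> [x y|a x].
- rewrite /weighted_sum -limD; [|exact: weighted_sum_cvg|exact: weighted_sum_cvg].
  apply: ler_lim; [exact: weighted_sum_cvg| |].
    by apply: is_cvgD; exact: weighted_sum_cvg.
  apply: nearW => N; rewrite /series/= fctE -big_split/=; apply: ler_sum => k _.
  by rewrite -mulrDr ler_wpM2l// dualD ler_normD.
- apply: cvg_lim => //.
  have -> : series (fun n => c n * `|v n (a *: x)|) =
      (fun=> `|a|) \* series (fun n => c n * `|v n x|).
    apply/funext => N; rewrite /series/= mulr_sumr; apply: eq_bigr => k _.
    by rewrite dualZ normrM mulrCA.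
  by apply: cvgM; [exact: cvg_cst|exact: weighted_sum_cvg].
Qed.

End Weight.

Lemma weighted_sum_skip C c n x : summable_weight C c ->
  weighted_sum c x = weighted_sum (skip_weight c n) x + c n * `|v n x|.
Proof.
move=> sc; apply: cvg_lim => //.
have cv := weighted_sum_cvg (skip_summable_weight n sc) (x := x).
apply: cvg_trans (cvgD cv (cvg_cst (c n * `|v n x|))).
apply: near_eq_cvg; exists n.+1 => // N nN.
rewrite /series/= fctE !big_mkord (bigD1 (Ordinal nN))//= [in RHS](bigD1 (Ordinal nN))//=.
rewrite {1}/skip_weight eqxx mul0r add0r addrC; congr (_ + _).
apply: eq_bigr => k kn; rewrite /skip_weight; case: eqP => // /eqP kn'.
by move: kn; rewrite -(inj_eq val_inj)/= kn'.
Qed.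
End WeightedSum.

(** * Fast subsequences *)

Section WeakConvergence.
Context {R : realType} {X : normedModType R}.

(** The weak topology is initial for a map into a product, where convergence is checked one
    functional at a time. *)
Lemma weakly_open_near (W : set X) (z : nat -> X) (x : X) :
  weakly_open W -> W x -> (forall f : dual X, f (z n) @[n --> \oo] --> (f x : R)) ->
  \forall n \near \oo, W (z n).
Proof.
pose h := (fun x : X => (fun f : dual X => f x) : {ptws dual X -> R^o}).
move=> [B oB <-] Bx zx.
suff : (h \o z) @ \oo --> (h x : {ptws dual X -> R^o}).
  by move=> /(_ B); apply; exact: open_nbhs_nbhs.
apply/cvg_sup => f; apply/cvg_image => //.
  by rewrite eqEsubset; split=> // r _; exists (fun=> r).
move=> A /(zx f) zA; exists ((fun g : dual X -> R^o => g f) @^-1` A) => //.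
by rewrite image_preimage// eqEsubset; split=> // r _; exists (fun=> r).
Qed.

End WeakConvergence.

Section FastSystem.
Context {R : realType} {X : normedModType R}.

(** At each step only finitely many [u k] have to be small, so weak nullity provides a suitable
    index beyond the previous one. *)
Lemma c0_system_fast (e : nat -> X) (E : nat -> dual X) (nu : X -> R)
    (u : nat -> dual X) (eta : nat -> R) :
  c0_system e E nu -> (forall n, 0 < eta n) ->
  exists e' E', c0_system e' E' nu /\
    forall k n, (k <= n)%N -> `|u k (e' n)| <= eta n.
Proof.
move=> sys eta0.
have next (nL : nat * nat) : exists N, (nL.2 < N)%N /\
    forall k, (k <= nL.1)%N -> `|u k (e N)| <= eta nL.1.
  case: nL => n L /=.
  have [N NP] : exists N, forall k m, (k < n.+1)%N -> (N <= m)%N -> `|u k (e m)| <= eta n.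
    apply: eventually_forall_ltn => k _.
    have /cvgrPdist_le/(_ _ (eta0 n))[N _ NP] := c0s_weakly_null sys (u k).
    by exists N => m /NP /=; rewrite sub0r normrN.
  exists (maxn N L.+1); split; first by rewrite leq_max ltnSn orbT.
  by move=> k kn; apply: NP => //; rewrite leq_max leqnn.
have [g gP] := choice next.
pose a := fix a n := if n is n'.+1 then g (n, a n') else g (0%N, 0%N).
have aS n : (a n < a n.+1)%N by have [] := gP (n.+1, a n).
exists (e \o a), (E \o a); split; first exact: c0_system_subseq.
by move=> k [|n] kn /=; [have [_ /(_ k kn)] := gP (0%N, 0%N)|have [_ /(_ k kn)] := gP (n.+1, a n)].
Qed.

End FastSystem.

Section HalfPower.
Context {R : realType}.

Definition half_pow (n : nat) : R := 2^-1 ^+ n.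

Lemma half_powD m n : half_pow (m + n) = half_pow m * half_pow n.
Proof. exact: exprD. Qed.

Lemma half_pow_gt0 n : 0 < half_pow n.
Proof. by rewrite exprn_gt0// invr_gt0. Qed.

Lemma half_pow_le m n : (m <= n)%N -> half_pow n <= half_pow m.
Proof. by move=> mn; rewrite ler_wiXn2l// ?invr_ge0// invf_le1// ler1n. Qed.

Lemma half_pow_le1 n : half_pow n <= 1.
Proof. by have := half_pow_le (leq0n n); rewrite [X in _ <= X]expr0. Qed.

Lemma half_pow_cvg : half_pow @ \oo --> (0 : R).
Proof. by apply: cvg_expr; rewrite ger0_norm ?invr_ge0// invf_lt1// ltr1n. Qed.

Lemma sum_half_pow N : \sum_(k < N) half_pow k <= 2.
Proof.
suff -> : \sum_(k < N) half_pow k = 2 - 2 * half_pow N.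
  by have := half_pow_gt0 N; lra.
elim: N => [|N IH]; first by rewrite big_ord0 /half_pow expr0; lra.
by rewrite big_ord_recr/= IH /half_pow exprS; lra.
Qed.

End HalfPower.

(** * The Read norm *)

Section Renorming.
Context {R : realType} {X : normedModType R}.
Variables (e : nat -> X) (E : nat -> dual X) (nu : X -> R) (ys : nat -> dual X).
Variables (K rho : R).
Hypothesis sys : c0_system e E nu.
Hypotheses (K0 : 0 < K) (le_nu : forall x, `|x| <= K * nu x) (rho0 : 0 < rho).
Hypothesis fast : forall k n, (k <= n)%N ->
  `|int_comb_enum ys K k (e n)| <= half_pow (2 * n * n + 2 * n).
Hypothesis ys_total : forall x, x != 0 -> exists j, ys j x != 0.

Let nnu : equivalent_norm nu := c0s_norm sys.
Let snu : seminorm nu := equivalent_norm_seminorm nnu.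
Local Notation w := (@half_pow R).

Definition read_functional : nat -> dual X := perturbed_enum ys K w E.
Local Notation v := read_functional.

(** The quadratic exponent makes [r k], for each [k > n], small compared with [r n * w n * w n]. *)
Definition read_weight (n : nat) : R := rho * w (2 * n * n).
Local Notation r := read_weight.

Definition read_sum : X -> R := weighted_sum v r.
Local Notation S := read_sum.

Definition read_norm_of (x : X) : R := nu x + S x.
Local Notation p := read_norm_of.

Definition read_sum_skip (n : nat) : X -> R := weighted_sum v (skip_weight r n).
Local Notation S' := read_sum_skip.

Let w0 n : 0 < w n. Proof. exact: half_pow_gt0. Qed.
Let w1 n : w n <= 1. Proof. exact: half_pow_le1. Qed.

Let r0 n : 0 < r n. Proof. exact: mulr_gt0. Qed.

Let nu_ge0 x : 0 <= nu x. Proof. exact: seminorm_ge0. Qed.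

Let u_le n x : `|int_comb_enum ys K n x| <= nu x.
Proof. by apply: le_trans (int_comb_enum_bound ys n x K0) _; rewrite ler_pdivrMl. Qed.

Lemma read_functionalE n x : v n x = int_comb_enum ys K n x + w n * E n x :> R.
Proof. by []. Qed.

Let v_le n x : `|v n x| <= 2 * nu x.
Proof.
rewrite read_functionalE (le_trans (ler_normD _ _))//.
have : `|w n * E n x| <= nu x.
  rewrite normrM gtr0_norm//; apply: le_trans (c0s_bound sys n x).
  by rewrite ler_piMl.
by have := u_le n x; lra.
Qed.

Let r_le k : r k <= rho * w k.
Proof.
by rewrite ler_pM2l//; apply: half_pow_le; rewrite -mulnA; case: k => // k; rewrite mulnCA leq_pmulr.
Qed.

Lemma read_weight_summable : summable_weight (2 * rho) r.
Proof.
split=> [n|N]; first exact: ltW.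
apply: (@le_trans _ _ (\sum_(k < N) rho * w k)); first by apply: ler_sum => k _.
by rewrite -mulr_sumr mulrC ler_pM2r// sum_half_pow.
Qed.

Let sr := read_weight_summable.

Let nu_e n : nu (e n) <= 1.
Proof.
have := c0s_shift sys n 0 1; rewrite add0r scale1r (seminorm0 snu) dual0 add0r normr1.
by rewrite max_r.
Qed.

Lemma read_functional_diag n : `|w n - v n (e n)| <= w (2 * n * n + 2 * n).
Proof.
rewrite read_functionalE (c0s_biorthogonal sys) eqxx mulr1 opprD addrCA subrr addr0.
by rewrite normrN; exact: fast.
Qed.

Lemma read_sum_seminorm : seminorm S.
Proof. exact (weighted_sum_seminorm v_le sr). Qed.

Let seminorm_S := read_sum_seminorm.

Let seminorm_S' n : seminorm (S' n) :=
  weighted_sum_seminorm v_le (skip_summable_weight n sr).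

Lemma read_sum_le x : S x <= 4 * rho * nu x.
Proof.
by have h : S x <= 2 * (2 * rho) * nu x := weighted_sum_le_norm v_le sr x; lra.
Qed.

Let S_le := read_sum_le.

Let S_skip n x : S x = S' n x + r n * `|v n x|.
Proof. exact: weighted_sum_skip sr. Qed.

(** The choice of the weights makes the other terms of the series negligible
    along [e n], compared with the [n]-th one, which is about [r n * w n]. *)
Lemma read_sum_skip_small n : S' n (e n) <= 2 * w n * (r n * w n).
Proof.
apply: (weighted_sum_le v_le (skip_summable_weight n sr)) => N.
apply: (@le_trans _ _ (\sum_(k < N) w n * (r n * w n) * w k)); last first.
  rewrite -mulr_sumr.
  have := ler_wpM2l (ltW (mulr_gt0 (w0 n) (mulr_gt0 (r0 n) (w0 n)))) (sum_half_pow (R := R) N).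
  by lra.
apply: ler_sum => k _; rewrite /skip_weight.
have [_|kn] := eqVneq (k : nat) n.
  by rewrite mul0r; apply/ltW; do !apply: mulr_gt0.
have wDE a b : w (a + b) = w a * w b by exact: half_powD.
have [k_lt|n_le] := ltnP k n.
(* Earlier terms: [E k] vanishes at [e n], and the exponent in [fast] is what turns [rho * w k] into
   [w n * (r n * w n) * w k]. *)
- have -> : v k (e n) = int_comb_enum ys K k (e n) :> R.
    by rewrite read_functionalE (c0s_biorthogonal sys) (negPf kn) mulr0 addr0.
  apply: le_trans (ler_pM (ltW (r0 k)) (normr_ge0 _) (r_le k) (fast (ltnW k_lt))) _.
  rewrite /read_weight wDE (mulnC 2 n) (_ : (n * 2 = n + n)%N) ?wDE; last by rewrite muln2 addnn.
  by rewrite le_eqVlt; apply/orP; left; apply/eqP; ring.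
- have {n_le kn}nk : (n < k)%N by rewrite ltn_neqAle eq_sym kn.
  (* Later terms: the weight alone suffices. The [1] in the exponent below absorbs this factor
     [2]. *)
  apply: (@le_trans _ _ (r k * 2)).
    rewrite ler_pM2l//; apply: le_trans (v_le k (e n)) _.
    by have := nu_e n; lra.
  have : w (2 * k * k) <= w (2 * n * n + n + n + k + 1).
    apply: half_pow_le.
    have : (n.+1 * n.+1 + n.+1 * n.+1 <= k * k + k * n.+1)%N.
      by apply: leq_add; [exact: leq_mul|rewrite leq_mul2r nk orbT].
    have : (k * (k - n.+1) + k * n.+1 = k * k)%N by rewrite -mulnDr subnK.
    nia.
  rewrite !wDE => h.
  have {}h : r k <= rho * (w (2 * n * n) * w n * w n * w k * w 1) by rewrite ler_pM2l.
  have w1E : w 1 = 2^-1 by rewrite /half_pow expr1.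
  by move: h; rewrite w1E /read_weight; lra.
Qed.

Let v_diag_le n : `|v n (e n)| <= 2 * w n.
Proof.
have : w (2 * n * n + 2 * n) <= w n.
  by apply: half_pow_le; rewrite mul2n -addnn !addnA leq_addl.
have := read_functional_diag n.
by have := ler_normB (w n) (w n - v n (e n)); rewrite subKr (gtr0_norm (w0 n)); lra.
Qed.

(** Makes the series vanish along the basis, as the diameter estimates require. *)
Lemma read_sum_basis_le n : S (e n) <= 4 * rho * w n.
Proof.
rewrite (S_skip n); have := read_sum_skip_small n; have := v_diag_le n.
have rr : r n <= rho by rewrite -[leRHS]mulr1 ler_pM2l.
move=> /(ler_wpM2l (ltW (r0 n))).
have : r n * w n <= rho * w n by rewrite ler_pM2r.
have : w n * (r n * w n) <= 1 * (rho * w n).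
  by apply: ler_pM; rewrite ?ler_pM2r// ltW// mulr_gt0.
by lra.
Qed.

Let p_between x : nu x <= p x <= (1 + 4 * rho) * nu x.
Proof.
rewrite /read_norm_of lerDl (seminorm_ge0 _ seminorm_S)/=.
by have := S_le x; lra.
Qed.

Lemma read_norm_equivalent : equivalent_norm p.
Proof.
apply: (equivalent_norm_between nnu _ p_between).
exact: seminormD seminorm_S.
Qed.

Let np := read_norm_equivalent.

Definition read_norm_skip n (x : X) : R := nu x + S' n x.
Local Notation q := read_norm_skip.

Let S'_ge0 n x : 0 <= S' n x.
Proof. exact: seminorm_ge0 (seminorm_S' n). Qed.

Let nq n : equivalent_norm (q n).
Proof.
apply: (equivalent_norm_between nnu (K := 1 + 4 * rho)).
  exact: seminormD (seminorm_S' n).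
move=> x; rewrite /read_norm_skip lerDl S'_ge0/=.
have := S_le x; rewrite (S_skip n).
have := mulr_ge0 (ltW (r0 n)) (normr_ge0 (v n x)); lra.
Qed.

Let pE n x : p x = q n x + r n * `|v n x|.
Proof. by rewrite /read_norm_of (S_skip n) addrA. Qed.

(** * Strict convexity of the norm and of its bidual norm *)

Let eval_form (x : X) : form (fun f : dual X => f x : R).
Proof. by []. Qed.

Let eval_bound (x : X) : exists B, forall n, `|E n x| <= B.
Proof. by exists (nu x) => n; exact: c0s_bound sys n x. Qed.

(** Totality at [y - a *: x] makes the evaluations at independent points independent on [ys]. Hence
    some [v n] takes opposite signs there, and its term is split off [p]. *)
Lemma read_norm_strictly_convex : strictly_convex p.
Proof.
apply: strictly_convex_sum => // x y x0 yx.
have [|a|n vn] := perturbed_enum_opposite (ys := ys) K0 half_pow_cvg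
  (eval_form x) (eval_bound x) (eval_form y) (eval_bound y).
- exact: ys_total.
- have [|j] := ys_total (x := y - a *: x).
    by rewrite subr_eq0; apply/eqP; exact: yx.
  rewrite dualD dualN dualZ subr_eq0 => yj; by exists j.
exists (q n), (r n), (fun z => v n z); split=> //; first exact: equivalent_norm_seminorm.
exact: dualD.
Qed.

(** The same argument one level up, where [bidual_normD] splits off the term. *)
Lemma read_norm_bidual_strictly_convex :
  (forall F : dual (dual X), F != 0 -> exists j, F (ys j) != 0) ->
  strictly_convex (dual_norm (dual_norm p)).
Proof.
move=> total.
have nddp := dual_norm_equivalent (dual_norm_equivalent np).
have F_form (F : dual (dual X)) : form F by exact: dual_linear.
have F_bound (F : dual (dual X)) : exists B, forall n, `|F (E n)| <= B.
  have [B B0 BF] := dual_equivalent_bound (dual_norm_equivalent nnu) F.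
  exists B => n; apply: (le_trans (BF (E n))); rewrite ler_piMr//.
  apply: (dual_norm_ub nnu) => x; exact: le_trans (c0s_bound sys n x).
apply: strictly_convex_sum => // F G F0 GF.
have [|a|n vn] := perturbed_enum_opposite (ys := ys) K0 half_pow_cvg
  (F_form F) (F_bound F) (F_form G) (F_bound G).
- exact: total.
- have [|j] := total (G - a *: F).
    by rewrite subr_eq0; apply/eqP; exact: GF.
  rewrite dualDE dualNE dualZE subr_eq0 => Gj; by exists j.
exists (dual_norm (dual_norm (q n))), (r n), (fun H : dual (dual X) => H (v n) : R); split=> //.
- exact: bidual_normD (ltW (r0 n)) (pE n).
- exact: dual_norm_seminorm (dual_norm_equivalent (nq n)).
Qed.

Let norm_add_small (a b : R) : `|b| <= `|a| -> `|a + b| = `|a| + Num.sg a * b.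
Proof.
have [a0|a0|->] := ltgtP a 0.
- rewrite (ltr0_norm a0) ltr0_sg// ler_norml => /andP[b1 b2].
  by rewrite ler0_norm; lra.
- rewrite (gtr0_norm a0) gtr0_sg// ler_norml => /andP[b1 b2].
  by rewrite ger0_norm; lra.
- by rewrite normr0 normr_le0 => /eqP ->; rewrite addr0 normr0 mulr0 addr0.
Qed.

(** For small [s] of either sign, [nu] does not grow at [x + s *: e n] and [v n] keeps its sign, so
    [p] grows linearly up to the skipped sum. As [h] is at most its norm times [p], with equality at
    [x], its slope is squeezed. *)
Lemma attaining_coordinate (h : dual X) (x : X) (n : nat) :
  p x = 1 -> h x = dual_norm p h -> `|E n x| < nu x -> v n x != 0 ->
  `|h (e n) - dual_norm p h * (r n * v n (e n) * Num.sg (v n x : R))|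
    <= dual_norm p h * S' n (e n).
Proof.
move=> px hx En vx; set c := dual_norm p h.
have c0 : 0 <= c by apply: seminorm_ge0; exact: dual_norm_seminorm.
have b1 : 0 < 1 + `|v n (e n)| by rewrite ltr_pwDl.
(* The first entry keeps the [n]-th coordinate below [nu x], the second keeps the sign of [v n]; the
   added [1] avoids division by zero. *)
pose t := Num.min (nu x - `|E n x|) (`|v n x| / (1 + `|v n (e n)|)).
have t0 : 0 < t by rewrite lt_min subr_gt0 En divr_gt0// normr_gt0.
have key (s : R) : `|s| = t ->
    s * h (e n) <= c * (t * S' n (e n) + s * (r n * v n (e n) * Num.sg (v n x : R))).
  move=> st.
  have nus : nu (x + s *: e n) <= nu x.
    apply: (le_trans (c0s_shift sys n x s)); rewrite ge_max lexx/=.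
    apply: (le_trans (ler_normD _ _)); rewrite st.
    have : t <= nu x - `|E n x| by rewrite ge_min lexx.
    lra.
  have S's : S' n (x + s *: e n) <= S' n x + t * S' n (e n).
    by have [S'D S'Z] := seminorm_S' n; rewrite -st -S'Z.
  have vs : `|v n (x + s *: e n)| = `|v n x| + Num.sg (v n x : R) * (s * v n (e n)).
    rewrite dualD dualZ norm_add_small// normrM st.
    have : t <= `|v n x| / (1 + `|v n (e n)|) by rewrite ge_min lexx orbT.
    rewrite ler_pdivlMr//; have := normr_ge0 (v n (e n)); nra.
  have ps : p (x + s *: e n) <= 1 + (t * S' n (e n) + s * (r n * v n (e n) * Num.sg (v n x : R))).
    by move: px; rewrite !(pE n) vs /read_norm_skip; lra.
  have := le_trans (ler_norm _) (dual_norm_le np h (x + s *: e n)).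
  rewrite dualD dualZ hx -/c => hs.
  have := ler_wpM2l c0 ps; lra.
have k1 := key t (gtr0_norm t0).
have := key (- t); rewrite normrN => /(_ (gtr0_norm t0)) k2.
rewrite ler_norml; apply/andP; split; rewrite -(ler_pM2l t0); lra.
Qed.

(** [h1] and [h2] are deviations left after two main terms have cancelled; the third main term, of
    size [c * A], must then be made up of errors. *)
Lemma sign_clash (h1 h2 sg3 A c d : R) : `|sg3| = 1 -> 0 <= A -> 0 <= c ->
  `|h1| <= d -> `|h2| <= d -> `|h1 + h2 - c * (A * sg3)| <= c * d ->
  c * A <= (2 + c) * d.
Proof.
move=> s3 A0 c0 h1d h2d h3d.
have : `|c * (A * sg3)| = c * A by rewrite !normrM s3 mulr1 !ger0_norm.
have := ler_normD (h1 + h2) (- (h1 + h2 - c * (A * sg3))).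
rewrite normrN subKr => h <-; apply: (le_trans h).
by have := ler_normD h1 h2; lra.
Qed.

(** If [f], [g], [f + g] and [f - g] attain their norms at [x1], ..., [x4], then
    their values at [e n] are proportional to [sg (v n (x i))] up to a small
    error. Whichever of the signs at [x1] and [x2] occur, they cancel in the sum
    or in the difference, while the third sign does not vanish. *)
Lemma read_norm_read : read_norm p.
Proof.
split=> // -[L [f [g [fg ->]]] LNA].
have f0 : f != 0.
  apply/eqP => f0; have [|/eqP] := fg 1 0; first by rewrite f0 scaler0 scale0r addr0.
  by rewrite oner_eq0.
have g0 : g != 0.
  apply/eqP => g0; have [|_ /eqP] := fg 0 1; first by rewrite g0 scaler0 scale0r addr0.
  by rewrite oner_eq0.
have ndp := dual_norm_equivalent np; have [_ dpZ] := dual_norm_seminorm np.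
(* With [f] and [g] normalized, both main terms have the same size and can cancel exactly. *)
pose a := (dual_norm p f)^-1; pose b := (dual_norm p g)^-1.
have f_gt0 := equivalent_norm_gt0 ndp f0; have g_gt0 := equivalent_norm_gt0 ndp g0.
have a0 : 0 < a by rewrite invr_gt0.
have b0 : 0 < b by rewrite invr_gt0.
have NA s t : exists2 x, p x = 1 & (s *: f + t *: g) x = dual_norm p (s *: f + t *: g).
  have [|x px hx] := LNA (s *: f + t *: g); first by exists s => //; exists t.
  by have [y py hy] := dual_norm_attained np px hx; exists y.
have ne0 s t : s != 0 -> 0 < dual_norm p (s *: f + t *: g).
  move=> s0; apply: (equivalent_norm_gt0 ndp); apply: contra_neq s0.
  by move=> /fg[].
have [x1 px1 fx1] := NA a 0; have [x2 px2 gx2] := NA 0 b.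
have a_neq0 : a != 0 by rewrite gt_eqF.
have [h3 h3E] : exists h, h = a *: f + b *: g by eexists.
have [h4 h4E] : exists h, h = a *: f + - b *: g by eexists.
have [x3 px3 sx3] := NA a b; have [x4 px4 dx4] := NA a (- b).
have c3 := ne0 a b a_neq0; have c4 := ne0 a (- b) a_neq0.
rewrite -h3E in sx3 c3; rewrite -h4E in dx4 c4.
rewrite scale0r addr0 in fx1; rewrite scale0r add0r in gx2.
have na : dual_norm p (a *: f) = 1 by rewrite dpZ gtr0_norm// mulVf// gt_eqF.
have nb : dual_norm p (b *: g) = 1 by rewrite dpZ gtr0_norm// mulVf// gt_eqF.
have [d3 d3E] : exists d, d = dual_norm p h3 by eexists.
have [d4 d4E] : exists d, d = dual_norm p h4 by eexists.
rewrite -d3E in c3; rewrite -d4E in c4.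
have px_neq0 x : p x = 1 -> x != 0.
  move=> px; apply: contra_eqN px => /eqP ->.
  by rewrite (seminorm0 (equivalent_norm_seminorm np)) eq_sym oner_eq0.
pose xs i := if i is 0%N then x1 else if i is 1%N then x2 else if i is 2 then x3 else x4.
have xs0 i : xs i != 0 by case: i => [|[|[|i]]]; exact: px_neq0.
have [N1 N1P] : exists N, forall i n, (i < 4)%N -> (N <= n)%N -> `|E n (xs i)| < nu (xs i).
  apply: eventually_forall_ltn => i _.
  by have [N _ NP] := c0s_inactive sys (xs0 i); exists N => n /NP.
(* A clash with norm [c'] yields [c' <= 4 * (2 + c') * w n]; [D] bounds the factor of [w n] for both
   [d3] and [d4]. *)
pose D := 4 * (2 + d3 + d4).
have D0 : 0 < D by rewrite /D; lra.
pose c := Num.min (d3) (d4).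
have c0 : 0 < c by rewrite lt_min c3.
have [N2 _ N2P] : \forall n \near \oo, w n < c / D.
  have cD : 0 < c / D by exact: divr_gt0.
  have /cvgrPdist_lt/(_ _ cD)[N _ NP] := half_pow_cvg (R := R).
  exists N => // n /NP /=; rewrite sub0r normrN; apply: le_lt_trans.
  exact: ler_norm.
have [n] := perturbed_enum_neq0 (ys := ys) (k := 4) K0 (half_pow_cvg (R := R))
    (maxn (maxn N1 N2) 1)
    (fun i _ => And3 (eval_form (xs i)) (eval_bound (xs i)) (ys_total (xs0 i))).
rewrite !geq_max -andbA => /and3P[N1n N2n n1] vx.
have act i : (i < 4)%N -> `|E n (xs i)| < nu (xs i) by move=> i4; exact: N1P.
have h1P := attaining_coordinate px1 fx1 (act 0%N isT) (vx 0%N isT).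
have h2P := attaining_coordinate px2 gx2 (act 1%N isT) (vx 1%N isT).
have h3P := attaining_coordinate px3 sx3 (act 2 isT) (vx 2 isT).
have h4P := attaining_coordinate px4 dx4 (act 3 isT) (vx 3 isT).
have sgP x : v n x != 0 -> `|Num.sg (v n x : R)| = 1.
  by move=> vxn; rewrite normr_sg vxn.
rewrite -d3E in h3P; rewrite -d4E in h4P.
set A := r n * v n (e n) in h1P h2P h3P h4P.
have Sn := read_sum_skip_small n.
(* Here [n >= 1] matters: it makes the diagonal error at most half of [w n]. *)
have A2 : r n * w n <= 2 * A.
  have : w (2 * n * n + 2 * n) <= 2^-1 * w n.
    have -> : 2^-1 = w 1 by rewrite /half_pow expr1.
    rewrite -half_powD; apply: half_pow_le.
    by rewrite (leq_trans (leq_add n1 (leqnn n)))// addnn -mul2n leq_addl.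
  have := read_functional_diag n; rewrite ler_norml => /andP[_ h] h'.
  by rewrite /A mulrCA ler_pM2l//; lra.
have rw0 : 0 < r n * w n by exact: mulr_gt0.
have contra c' : c' <= d3 + d4 ->
    c <= c' -> c' * A <= (2 + c') * S' n (e n) -> False.
  move=> c'D cc' cA; have := N2P n N2n; rewrite /= ltr_pdivlMr// => wD.
  have c'0 : 0 < c' by exact: lt_le_trans c0 cc'.
  have s1 : c' * (r n * w n) <= 2 * (c' * A) by rewrite [leRHS]mulrCA ler_pM2l.
  have s2 : (2 + c') * S' n (e n) <= (2 + c') * (2 * w n * (r n * w n)).
    by rewrite ler_pM2l//; lra.
  have s3 : 2 * ((2 + c') * (2 * w n)) <= w n * D.
    by have := ler_wpM2l (ltW (w0 n)) c'D; rewrite /D; lra.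
  have : w n * D * (r n * w n) < c' * (r n * w n).
    by rewrite ltr_pM2r//; exact: lt_le_trans wD cc'.
  have := ler_wpM2r (ltW rw0) s3; lra.
have A0 : 0 <= A by have := rw0; lra.
have S0 : 0 <= S' n (e n) by [].
rewrite na !mul1r in h1P; rewrite nb !mul1r in h2P.
have [ss|ss] : Num.sg (v n x2 : R) = - Num.sg (v n x1 : R) \/ Num.sg (v n x2 : R) = Num.sg (v n x1 : R).
  have := vx 0%N isT; have := vx 1%N isT => /=.
  case: (sgrP (v n x1 : R)); case: (sgrP (v n x2 : R)) => // _ _ _ _; first by right.
  - by left.
  - by left; rewrite opprK.
  - by right.
- apply: (contra d3).
  + by rewrite lerDl ltW.
  + by rewrite ge_min lexx.
  apply: (sign_clash (sgP _ (vx 2 isT)) A0 (ltW c3) h1P h2P).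
  by move: h3P; rewrite ss h3E dualDE; congr (`| _ | <= _); lra.
- apply: (contra d4).
  + by rewrite lerDr ltW.
  + by rewrite ge_min lexx orbT.
  rewrite -normrN in h2P.
  apply: (sign_clash (sgP _ (vx 3 isT)) A0 (ltW c4) h1P h2P).
  by move: h4P; rewrite ss h4E scaleNr dualDE dualNE; congr (`| _ | <= _); lra.
Qed.

End Renorming.

(** * Large slices *)

Section LargeSlices.
Context {R : realType} {X : normedModType R}.
Variables (e : nat -> X) (E : nat -> dual X) (nu S : X -> R) (theta rho : R).
Hypothesis sys : c0_system e E nu.
Hypotheses (sS : seminorm S) (theta0 : 0 <= theta).
Hypothesis S_le : forall x, S x <= theta * nu x.
Hypothesis S_e : S (e n) @[n --> \oo] --> (0 : R).
Hypotheses (rho0 : 0 < rho) (rho_lt : rho * (1 + theta) < 2).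

Definition perturbed_norm (x : X) : R := nu x + S x.
Local Notation p := perturbed_norm.

Let pE x : p x = nu x + S x. Proof. by []. Qed.

Let nnu : equivalent_norm nu := c0s_norm sys.
Let snu : seminorm nu := equivalent_norm_seminorm nnu.

Let nu_ge0 x : 0 <= nu x. Proof. exact: seminorm_ge0. Qed.
Let S_ge0 x : 0 <= S x. Proof. exact: seminorm_ge0. Qed.

Lemma perturbed_norm_equivalent : equivalent_norm p.
Proof.
apply: (equivalent_norm_between nnu (seminormD snu sS) (K := 1 + theta)) => x.
by rewrite lerDl S_ge0/=; have := S_le x; lra.
Qed.

Let np := perturbed_norm_equivalent.
Let sp : seminorm p := equivalent_norm_seminorm np.

Let k n : R := 1 + 2 * S (e n).

Let k_ge1 n : 1 <= k n.
Proof. by rewrite lerDl mulr_ge0. Qed.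

Let k_gt0 n : 0 < k n.
Proof. exact: lt_le_trans (k_ge1 n). Qed.

Let k_cvg : k @ \oo --> (1 : R).
Proof.
rewrite -[X in _ --> X]addr0 -[X in _ --> _ + X](mulr0 2).
by apply: cvgD; [exact: cvg_cst|apply: cvgM => //; exact: cvg_cst].
Qed.

Let p_e_ge1 n : 1 <= p (e n).
Proof.
have := c0s_bound sys n (e n); rewrite (c0s_biorthogonal sys) eqxx normr1.
by rewrite pE; have := S_ge0 (e n); lra.
Qed.

(** Replacing the [E n]-coordinate of a unit vector [x] by [s * nu x], with
    [`|s| = 1], does not increase [nu] and increases [S] by at most
    [2 * S (e n)], so that the rescaled vector is again in the unit ball. *)
Definition bump (x : X) (s : R) (n : nat) : X :=
  (k n)^-1 *: (x + (s * nu x - E n x) *: e n).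

Let bump_coef_le x s n : `|s| = 1 -> `|s * nu x - E n x| <= 2 * nu x.
Proof.
move=> s1; apply: (le_trans (ler_normB _ _)).
by rewrite normrM s1 mul1r ger0_norm//; have := c0s_bound sys n x; lra.
Qed.

Lemma bump_ball x s n : p x = 1 -> `|s| = 1 -> p (bump x s n) <= 1.
Proof.
move=> px s1; have [_ pZ] := sp; rewrite /bump pZ gtr0_norm ?invr_gt0//.
rewrite ler_pdivrMl// mulr1; rewrite !pE in px *.
have nux : nu (x + (s * nu x - E n x) *: e n) <= nu x.
  apply: (le_trans (c0s_shift sys n x _)).
  have -> : E n x + (s * nu x - E n x) = s * nu x :> R by lra.
  by rewrite normrM s1 mul1r ger0_norm// ge_max lexx.
have [SD SZ] := sS.
have : S (x + (s * nu x - E n x) *: e n) <= S x + 2 * nu x * S (e n).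
  apply: (le_trans (SD _ _)); rewrite lerD2l SZ ler_wpM2r//.
  exact: bump_coef_le.
have : nu x * S (e n) <= S (e n) by rewrite ler_piMl//; have := S_ge0 x; lra.
by rewrite /k; lra.
Qed.

Lemma bump_cvg (f : dual X) x s : `|s| = 1 ->
  f (bump x s n) @[n --> \oo] --> (f x : R).
Proof.
move=> s1.
have -> : (fun n => f (bump x s n) : R) =
    (fun n => (k n)^-1 * (f x + (s * nu x - E n x) * f (e n))).
  by apply/funext => n; rewrite /bump dualZ dualD dualZ.
suff : (fun n => (k n)^-1 * (f x + (s * nu x - E n x) * f (e n))) @ \oo -->
    (1^-1 * (f x + 0) : R) by rewrite invr1 mul1r addr0.
apply: cvgM; first by apply: cvgV => //; exact: oner_neq0.
apply: cvgD; first exact: cvg_cst.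
apply/norm_cvg0P; apply: (@squeeze_cvgr _ _ _ _ (fun=> 0) (fun n => 2 * nu x * `|f (e n)|)).
- apply: nearW => n; rewrite normr_ge0/= normrM ler_wpM2r//.
  exact: bump_coef_le.
- exact: cvg_cst.
- rewrite -[X in _ --> X](mulr0 (2 * nu x)); apply: cvgM; first exact: cvg_cst.
  exact/norm_cvg0P/(c0s_weakly_null sys f).
Qed.

(** All these differences are nonnegative multiples of the same vector [e n], so they cannot cancel
    in a convex combination. *)
Lemma bumpB x n : bump x 1 n - bump x (-1) n = (2 * nu x / k n) *: e n.
Proof.
rewrite /bump -scalerBr opprD addrACA subrr add0r -scalerBl scalerA.
by congr (_ *: _); rewrite mulrC; congr (_ / _); lra.
Qed.

Let nu_sphere x : p x = 1 -> 1 <= (1 + theta) * nu x.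
Proof. by rewrite pE => px; have := S_le x; lra. Qed.

Let rho_near (r : R) : r * (1 + theta) < 2 -> \forall n \near \oo, r * k n * (1 + theta) <= 2.
Proof.
move=> rt.
have : (fun n => r * k n * (1 + theta)) @ \oo --> (r * 1 * (1 + theta) : R).
  by apply: cvgM; [apply: cvgM => //; exact: cvg_cst|exact: cvg_cst].
by move/cvgr_le; apply; rewrite mulr1.
Qed.

Let rho_le (r : R) n x : 0 <= r -> p x = 1 -> r * k n * (1 + theta) <= 2 -> r <= 2 * nu x / k n.
Proof.
move=> r0 /nu_sphere nux rk; rewrite ler_pdivlMr//.
have t1 : 0 < 1 + theta by rewrite ltr_pwDl.
rewrite -(ler_pM2r t1); apply: (le_trans rk); lra.
Qed.

(** Choose a unit vector in each slice. For one large [n] all bumps stay in their slices, and the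
    two combined points differ by a multiple of [e n] whose coefficient is an average of numbers at
    least [rho]. *)
Lemma convex_combination_of_slices_diam (C : set X) :
  is_convex_combination_of_slices (unit_ball p) C -> (rho%:E <= diam p C)%E.
Proof.
move=> [N [t [Sl [slS t0 t1 ->]]]].
have pick i : exists2 x, p x = 1 & forall s, `|s| = 1 ->
    \forall n \near \oo, Sl i (bump x s n).
  have [f [al [f0 al0 ->]]] := slS i.
  pose sf := sup ((f : X -> R) @` unit_ball p).
  have ne : ((f : X -> R) @` unit_ball p) !=set0.
    by exists (f 0), 0 => //; rewrite /unit_ball/= (seminorm0 sp) ler01.
  have e0 : e 0%N != 0.
    apply: contraTneq (p_e_ge1 0) => ->.
    by rewrite (seminorm0 sp) -ltNge ltr01.
  have [|_ [x px <-] fx] := @sup_gt R ((f : X -> R) @` unit_ball p) (sf - al) ne.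
    by rewrite ltrBlDr ltrDl.
  have [||y py fy] := @sphere_gt _ _ _ np f (sf - al) _ e0.
  - by move=> fz; move: f0; rewrite fz eqxx.
  - by exists x.
  exists y => // s s1; near=> n; split; first exact: bump_ball.
  by near: n; have /cvgr_gt := bump_cvg (f := f) (x := y) s1; apply.
have [x px xS] : exists2 x : 'I_N -> X, forall i, p (x i) = 1 &
    forall i s, `|s| = 1 -> \forall n \near \oo, Sl i (bump (x i) s n).
  have /choice[x xP] : forall i, exists x, p x = 1 /\ forall s, `|s| = 1 ->
      \forall n \near \oo, Sl i (bump x s n).
    by move=> i; have [x] := pick i; exists x.
  by exists x => i; have [] := xP i.
have : \forall n \near \oo, rho * k n * (1 + theta) <= 2 /\
    forall i, Sl i (bump (x i) 1 n) /\ Sl i (bump (x i) (-1) n).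
  near=> n; split; first by near: n; exact: rho_near.
  near: n; apply: filter_forall => i; apply: filterI; apply: xS.
    exact: normr1.
  exact: normrN1.
move=> [n _ /(_ n (leqnn n))[rk inS]].
apply: ereal_sup_ge.
exists (p (\sum_i t i *: bump (x i) 1 n - \sum_i t i *: bump (x i) (-1) n))%:E.
  exists (\sum_i t i *: bump (x i) 1 n).
    by exists (fun i => bump (x i) 1 n) => // i; have [] := inS i.
  exists (\sum_i t i *: bump (x i) (-1) n) => //.
  by exists (fun i => bump (x i) (-1) n) => // i; have [] := inS i.
rewrite lee_fin -sumrB.
have -> : \sum_i (t i *: bump (x i) 1 n - t i *: bump (x i) (-1) n) =
    (\sum_i t i * (2 * nu (x i) / k n)) *: e n.
  by rewrite scaler_suml; apply: eq_bigr => i _; rewrite -scalerBr bumpB scalerA.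
have [_ pZ] := sp; rewrite pZ.
have rs : rho <= \sum_i t i * (2 * nu (x i) / k n).
  rewrite -[leLHS]mul1r -{1}t1 mulr_suml; apply: ler_sum => i _.
  apply: ler_wpM2l => //. apply: rho_le => //; exact: ltW.
apply: (le_trans rs); apply: le_trans (ler_norm _) _.
by rewrite ler_peMr.
Unshelve. all: by end_near. Qed.

(** Moving along a far [e n] reaches the sphere inside [W], by weak nullity; the two bumps of the
    point reached are then weakly close to it. *)
Lemma weakly_open_diam (W : set X) : weakly_open W -> W `&` unit_ball p !=set0 ->
  (rho%:E <= diam p (W `&` unit_ball p))%E.
Proof.
move=> oW [x0 [Wx0 x0p]].
have [x Wx px] : exists2 x, W x & p x = 1.
  have step n : exists2 s : R, `|s| <= 2 & p (x0 + s *: e n) = 1.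
    have [pD pZ] := sp.
    have cp : continuous (fun s : R => p (x0 + s *: e n) : R^o).
      move=> s; apply/cvgrPdist_le => d d0.
      have pe : 0 < p (e n) by exact: lt_le_trans (p_e_ge1 n).
      exists (d / p (e n)) => /=; first exact: divr_gt0.
      move=> s' /= ss'; have lip (a b : R) :
          p (x0 + a *: e n) - p (x0 + b *: e n) <= `|a - b| * p (e n).
        have := pD (x0 + b *: e n) ((a - b) *: e n).
        by rewrite -addrA -scalerDl (addrC b) subrK pZ; lra.
      have l1 := lip s s'; have l2 := lip s' s; rewrite (distrC s') in l2.
      have : `|s - s'| * p (e n) <= d by rewrite -ler_pdivlMr// ltW.
      by rewrite ler_norml => ?; apply/andP; split; lra.
    (* At [s = 2] the norm is at least [2 * p (e n) - p x0 >= 1], and at [s = 0] it is at most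
       one. *)
    have [||s sI ps] := @IVT R (fun s => p (x0 + s *: e n)) 0 2 1 (ler0n _ 2).
    - by apply: continuous_subspaceT.
    - have : 1 <= p (x0 + 2 *: e n).
        have := pD (x0 + 2 *: e n) (- x0); rewrite addrAC subrr add0r pZ ger0_norm//.
        rewrite seminormN//; have := p_e_ge1 n; move: x0p; rewrite /unit_ball/=; lra.
      rewrite scale0r addr0 => h; rewrite ge_min le_max; apply/andP; split.
        by apply/orP; left.
      by apply/orP; right.
    exists s => //; move: sI; rewrite in_itv/= => /andP[s0 s2].
    by rewrite ger0_norm.
  have [s sP] := choice (fun n => match step n with ex_intro2 s h1 h2 => ex_intro _ s (conj h1 h2) end).
  have cvx (f : dual X) : f (x0 + s n *: e n) @[n --> \oo] --> (f x0 : R).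
    have -> : (fun n => f (x0 + s n *: e n) : R) = (fun n => f x0 + s n * f (e n)).
      by apply/funext => n; rewrite dualD dualZ.
    suff : (fun n => f x0 + s n * f (e n)) @ \oo --> (f x0 + 0 : R) by rewrite addr0.
    apply: cvgD; first exact: cvg_cst.
    apply/norm_cvg0P; apply: (@squeeze_cvgr _ _ _ _ (fun=> 0) (fun n => 2 * `|f (e n)|)).
    - apply: nearW => n; rewrite normr_ge0/= normrM ler_wpM2r//.
      by have [] := sP n.
    - exact: cvg_cst.
    - rewrite -[X in _ --> X](mulr0 2); apply: cvgM; first exact: cvg_cst.
      exact/norm_cvg0P/(c0s_weakly_null sys f).
  have [n _ /(_ n (leqnn n)) Wn] := weakly_open_near oW Wx0 cvx.
  by exists (x0 + s n *: e n) => //; have [] := sP n.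
have : \forall n \near \oo, [/\ rho * k n * (1 + theta) <= 2, W (bump x 1 n) &
    W (bump x (-1) n)].
  near=> n; split; near: n.
  - exact: rho_near.
  - by apply: (weakly_open_near oW Wx) => f; apply: bump_cvg; exact: normr1.
  - by apply: (weakly_open_near oW Wx) => f; apply: bump_cvg; exact: normrN1.
move=> [n _ /(_ n (leqnn n))[rk W1 W2]].
apply: ereal_sup_ge; exists (p (bump x 1 n - bump x (-1) n))%:E.
  exists (bump x 1 n); first by split=> //; apply: bump_ball => //; exact: normr1.
  by exists (bump x (-1) n) => //; split=> //; apply: bump_ball => //; exact: normrN1.
rewrite lee_fin bumpB; have [_ pZ] := sp; rewrite pZ.
have rs : rho <= 2 * nu x / k n by apply: rho_le => //; exact: ltW.
apply: (le_trans rs); apply: le_trans (ler_norm _) _.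
by rewrite ler_peMr.
Unshelve. all: by end_near. Qed.

(** The directions are [eta *: E n]: both bumps of a unit vector nearly norming [f] still nearly
    norm [f], while [E n] separates them by more than [rho]. *)
Lemma dual_norm_rough : rough rho (dual_norm p).
Proof.
move=> f; have ndp := dual_norm_equivalent np.
have [_ dZ] := dual_norm_seminorm np.
have [_ _ _ [m [M [m0 nuM]]]] := nnu.
pose M' := Num.max M 0.
have M'0 : 0 <= M' by rewrite le_max lexx orbT.
have E_norm n : `|E n| <= M'.
  apply: (dual_norm_ub (norm_equivalent_norm X)) => x x1.
  apply: (le_trans (c0s_bound sys n x)); have /andP[_ h] := nuM x; apply: (le_trans h).
  apply: (@le_trans _ _ (M' * `|x|)); first by rewrite ler_wpM2r// le_max lexx.
  by rewrite ler_piMr.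
have pE_le1 n : dual_norm p (E n) <= 1.
  apply: (dual_norm_ub np) => x; apply: le_trans.
  by apply: (le_trans (c0s_bound sys n x)); rewrite pE lerDl.
have E_neq0 n : E n != 0.
  apply/eqP => En0; have := c0s_biorthogonal sys n n.
  by rewrite En0 dual0E eqxx => /eqP; rewrite eq_sym oner_eq0.
apply: le_ereal_inf_tmp => _ [A /nbhs_norm0P[d /= d0 dA] <-].
pose eta := d / (2 * (1 + M')).
have eta0 : 0 < eta by rewrite divr_gt0// mulr_gt0// ltr_pwDl.
have t1 : 0 < 1 + theta by rewrite ltr_pwDl.
(* The surplus [4 * kap] pays for four losses of [kap * eta]: the near-norming vector counts twice,
   each of its bumps once. *)
have [kap kap0 kap_lt] : exists2 kap, 0 < kap & (rho + 4 * kap) * (1 + theta) < 2.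
  exists ((2 - rho * (1 + theta)) / (8 * (1 + theta))).
    by rewrite divr_gt0 ?mulr_gt0// subr_gt0.
  rewrite (_ : (_ + _) * _ = 1 + rho * (1 + theta) / 2).
    by have := rho_lt; lra.
  by field; rewrite gt_eqF.
have e0 : e 0%N != 0.
  by apply: contraTneq (p_e_ge1 0) => ->; rewrite (seminorm0 sp) -ltNge ltr01.
have pf_lt : dual_norm p f - kap * eta < dual_norm p f by rewrite ltrBlDr ltrDl mulr_gt0.
have [||x px fx] := sphere_gt np (f := f) (k := dual_norm p f - kap * eta) e0.
- move=> ->; rewrite (seminorm0 (dual_norm_seminorm np)) sub0r oppr_lt0.
  exact: mulr_gt0.
- by have [y py fy] := dual_norm_gt np pf_lt; exists y.
have : \forall n \near \oo, [/\ (rho + 4 * kap) * k n * (1 + theta) <= 2,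
    f x - kap * eta < f (bump x 1 n) & f x - kap * eta < f (bump x (-1) n)].
  have fx_lt : f x - kap * eta < f x by rewrite ltrBlDr ltrDl mulr_gt0.
  near=> n; split; near: n.
  - exact: rho_near.
  - by have /cvgr_gt := bump_cvg (f := f) (x := x) (normr1 R); apply.
  - by have /cvgr_gt := bump_cvg (f := f) (x := x) (normrN1 R); apply.
move=> [n _ /(_ n (leqnn n))[rk f1 f2]].
have h_neq0 : eta *: E n != 0 by rewrite scaler_eq0 negb_or gt_eqF//=.
apply: ereal_sup_ge; exists ((dual_norm p (f + eta *: E n) + dual_norm p (f - eta *: E n)
    - 2 * dual_norm p f) / dual_norm p (eta *: E n))%:E.
  exists (eta *: E n) => //; apply: (dA _ _ h_neq0) => /=.
  rewrite normrZ gtr0_norm//; apply: le_lt_trans (ler_wpM2l (ltW eta0) (E_norm n)) _.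
  rewrite /eta mulrAC ltr_pdivrMr; last by rewrite mulr_gt0// ltr_pwDl.
  by rewrite ltr_pM2l//; lra.
rewrite lee_fin ler_pdivlMr; last exact: equivalent_norm_gt0.
have h1 : (f + eta *: E n) (bump x 1 n) <= dual_norm p (f + eta *: E n).
  apply: le_trans (ler_norm _) _; apply: (dual_norm_ge np).
  by apply: bump_ball => //; exact: normr1.
have h2 : (f - eta *: E n) (bump x (-1) n) <= dual_norm p (f - eta *: E n).
  apply: le_trans (ler_norm _) _; apply: (dual_norm_ge np).
  by apply: bump_ball => //; exact: normrN1.
have Eb : E n (bump x 1 n) - E n (bump x (-1) n) = 2 * nu x / k n :> R.
  by rewrite -dualN -dualD bumpB dualZ (c0s_biorthogonal sys) eqxx mulr1.
have rk' : rho + 4 * kap <= 2 * nu x / k n.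
  by apply: rho_le => //; rewrite addr_ge0 ?mulr_ge0// ltW.
rewrite dualDE dualZE in h1; rewrite dualDE dualNE dualZE in h2.
rewrite dZ gtr0_norm//.
have : rho * (eta * dual_norm p (E n)) <= rho * (eta * 1) by rewrite !ler_pM2l.
have := ler_wpM2l (ltW eta0) rk'; rewrite -Eb.
move: (dual_norm p (E n)) (dual_norm p f) (dual_norm p (f + _)) (dual_norm p (f - _))
  (E n (bump x 1 n)) (E n (bump x (-1) n)) (f (bump x 1 n) : R) (f (bump x (-1) n) : R)
  (f x : R) h1 h2 fx f1 f2.
by move=> *; lra.
Unshelve. all: by end_near. Qed.

End LargeSlices.

(** * Main result *)

Section TotalSequence.
Context {R : realType} {X : normedModType R}.

Lemma dense_vanish (A : set (dual X)) (phi : dual X -> R) (B : R) : dense A ->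
  (forall f g, phi (f - g) = phi f - phi g) -> (forall f, `|phi f| <= B * `|f|) ->
  (forall f, A f -> phi f = 0) -> forall f, phi f = 0.
Proof.
move=> dA phiB phi_le phiA f; apply/eqP; apply: contraT => phif.
have B0 : 0 < B.
  rewrite ltNge; apply/negP => B0; move: phif; rewrite -normr_le0 => /negP; apply.
  by apply: (le_trans (phi_le f)); rewrite mulr_le0_ge0.
have d0 : 0 < `|phi f| / B by rewrite divr_gt0// normr_gt0.
have [g [fg Ag]] : ball f (`|phi f| / B) `&` A !=set0.
  by apply: dA; [exists f; exact: ballxx|exact: ball_open].
have : `|phi f| < `|phi f|; last by rewrite ltxx.
rewrite -{1}[phi f]subr0 -(phiA g Ag) -phiB; apply: le_lt_trans (phi_le _) _.
by move: fg; rewrite -ball_normE /= ltr_pdivlMr// mulrC.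
Qed.

(** A norming system is total on [X]. If the dual is separable, a dense sequence is taken instead;
    density makes it total on the bidual and, through the norming system, on [X]. *)
Lemma exists_total_sequence :
  (exists xs : nat -> dual X, norming_system xs) ->
  exists ys : nat -> dual X, (forall x, x != 0 -> exists j, ys j x != 0) /\
    (separable (dual X) -> forall F : dual (dual X), F != 0 -> exists j, F (ys j) != 0).
Proof.
move=> [xs [_ [K K0 Kx]]].
have total x : (forall j, xs j x = 0 :> R) -> x = 0.
  move=> xs0; apply/eqP; rewrite -normr_le0; apply: (le_trans (Kx x)).
  have -> : range (fun n => `|xs n x|) = [set 0].
    rewrite eqEsubset; split=> [_ [n _ <-]|_ ->]; first by rewrite /= xs0 normr0.
    by exists 0%N => //; rewrite xs0 normr0.
  by rewrite sup1 mulr0.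
have [[A cA dA]|nsep] := pselect (separable (dual X)); last first.
  exists xs; split=> // x x0; apply/not_existsP => xs0; move/eqP: x0; apply.
  by apply: total => j; apply/eqP/negP => /negP; exact: xs0.
move: (cA) => /countable_injP[h hinj].
(* Inverts the injection [h] of the dense set into the integers, with value [0] outside its
   range. *)
have pick n : exists y : dual X, forall a, A a -> h a = n -> y = a.
  have [[a [Aa han]]|na] := pselect (exists a, A a /\ h a = n).
    by exists a => b Ab hbn; apply: hinj; rewrite ?inE// han.
  by exists 0 => a Aa han; case: na; exists a.
have [ys ysP] := choice pick.
have ysA a : A a -> ys (h a) = a by move=> Aa; exact: ysP.
exists ys; split=> [x x0|_ F F0]; apply/not_existsP => ys0.
- move/eqP: x0; apply; apply: total => j.
  apply: (@dense_vanish A (fun f => f x : R) `|x| dA) => // [f|f Af].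
    by rewrite mulrC; exact: norm_dual_le.
  by rewrite -(ysA f Af); apply/eqP/negP => /negP; exact: ys0.
- move/eqP: F0; apply; apply: dual_ext => f; rewrite dual0E.
  apply: (@dense_vanish A (fun f => F f : R) `|F| dA) => // [g g'|g|g Ag].
  + by rewrite dualD dualN.
  + exact: norm_dual_le.
  + by rewrite -(ysA g Ag); apply/eqP/negP => /negP; exact: ys0.
Qed.

End TotalSequence.

Theorem proposition4p4 (R : realType) (X : completeNormedModType R)
    (hc0 : contains_copy (c0 R) X)
    (hnorming : exists xs : nat -> dual X, norming_system xs)
    (e : R) (he : 0 < e < 2) :
  exists p : X -> R,
    [/\ read_norm p,
        strictly_convex p,
        (forall C : set X,
            is_convex_combination_of_slices (unit_ball p) C ->
            ((2 - e)%:E <= diam p C)%E) /\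
        (forall W : set X,
            weakly_open W -> W `&` unit_ball p !=set0 ->
            ((2 - e)%:E <= diam p (W `&` unit_ball p))%E),
        rough (2 - e) (dual_norm p) &
        separable (dual X) ->
          strictly_convex (dual_norm (dual_norm p)) /\ smooth (dual_norm p)].
Proof.
have /andP[e0 e2] := he.
have [T [m [M [m0 TmM]]]] := hc0.
have [b0 [E0 [nu sys0]]] := c0_system_of_copy m0 TmM.
have [ys [ysX ysX2]] := exists_total_sequence hnorming.
have [_ _ _ [k [k' [k0 nuk]]]] := c0s_norm sys0.
have K0 : 0 < k^-1 by rewrite invr_gt0.
have le_nu x : `|x| <= k^-1 * nu x by rewrite ler_pdivlMl//; have /andP[] := nuk x.
have [b [E [sys fast]]] := c0_system_fast (int_comb_enum ys k^-1)
  sys0 (fun n => half_pow_gt0 (2 * n * n + 2 * n)).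
(* With this weight [S <= e / 4 * nu], and [(2 - e) * (1 + e / 4) < 2] as the diameter estimates
   require. *)
have rho0 : 0 < e / 16 by rewrite divr_gt0.
pose S := read_sum E ys k^-1 (e / 16).
have pread := read_norm_read sys K0 le_nu rho0 fast ysX.
have sS : seminorm S := read_sum_seminorm ys sys K0 le_nu rho0.
have S_le x : S x <= e / 4 * nu x.
  by have h : S x <= 4 * (e / 16) * nu x := read_sum_le ys sys K0 le_nu rho0 x; lra.
have S_b : S (b n) @[n --> \oo] --> 0.
  apply: (@squeeze_cvgr _ _ _ _ (fun=> 0) (fun n => 4 * (e / 16) * half_pow n)).
  - apply: nearW => n; rewrite (seminorm_ge0 _ sS)/=.
    exact: read_sum_basis_le sys K0 le_nu rho0 fast n.
  - exact: cvg_cst.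
  - rewrite -[X in _ --> X](mulr0 (4 * (e / 16))).
    by apply: cvgM; [exact: cvg_cst|exact: half_pow_cvg].
have e4 : 0 <= e / 4 by rewrite divr_ge0// ltW.
have r0 : 0 < 2 - e by rewrite subr_gt0.
have r2 : (2 - e) * (1 + e / 4) < 2 by nra.
exists (perturbed_norm nu S); split.
- exact: pread.
- exact: read_norm_strictly_convex sys K0 le_nu rho0 ysX.
- split.
    exact: convex_combination_of_slices_diam sys sS e4 S_le S_b r0 r2.
  exact: weakly_open_diam sys sS e4 S_le S_b r0 r2.
- exact: dual_norm_rough sys sS e4 S_le S_b r0 r2.
- move=> sep.
  have sc := read_norm_bidual_strictly_convex sys K0 le_nu rho0 (ysX2 sep).
  split; first exact: sc.
  apply: smooth_of_strictly_convex_dual sc.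
  apply: dual_norm_equivalent.
  exact (read_norm_equivalent ys sys K0 le_nu rho0).
Qed.
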